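(* In the weak model set setting below: (a) $(\hat X,G)$ is (topologically conjugate to) the maximal equicontinuous generic factor of $(X,G)$. (b) If the window $W$ is Haar aperiodic, then $(\hat X,G)$ is also (topologically conjugate to) the maximal equicontinuous generic factor of $(X^G,G)$.
   Context: $G$ and $H$ are locally compact second countable abelian groups with Haar measures $m_G,m_H$. $\mathcal L\subseteq G\times H$ is a cocompact lattice (discrete subgroup with compact quotient) such that the projection $\pi^G:G\times H\to G$ is injective on $\mathcal L$ and $\pi^H(\mathcal L)$ is dense in $H$. $\hat X:=(G\times H)/\mathcal L$ with normalized Haar probability $m_{\hat X}$, and $G$ acts on $\hat X$ by $g(x+\mathcal L)=(g,0)+x+\mathcal L$. The window $W\subseteq H$ is compact with $m_H(W)>0$. $\mathcal M$ and $\mathcal M^G$ are the spaces of locally finite Borel measures on $G\times H$ and $G$ with the vague topology; $G$ acts by translations. For $\hat x=x+\mathcal L$, $\nu_W(\hat x):=\sum_{y\in(x+\mathcal L)\cap(G\times W)}\delta_y$ and $\nu^G_W(\hat x):=\pi^G_*\nu_W(\hat x)$. $\mathcal M_W$, $\mathcal M^G_W$ are the vague closures of $\nu_W(\hat X)$, $\nu^G_W(\hat X)$ (compact, $G$-invariant). Mirsky measures: $Q_{\mathcal M}:=m_{\hat X}\circ\nu_W^{-1}$, $Q_{\mathcal M^G}:=m_{\hat X}\circ(\nu^G_W)^{-1}$. $X\subseteq\mathcal M_W$ and $X^G\subseteq\mathcal M^G_W$ are the topological supports of $Q_{\mathcal M}$, $Q_{\mathcal M^G}$ with the restricted $G$-actions.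 $W$ is Haar aperiodic if $m_H((h+W)\triangle W)=0$ implies $h=0$. For a system $(Y,G)$ ($Y$ compact metrizable) with set of transitive points $Y_t=\{y:\overline{Gy}=Y\}$, an equicontinuous generic factor is a compact metrizable minimal equicontinuous system $(Z,G)$ with a continuous $G$-equivariant map $Y_t\to Z$; the maximal one (which exists and is unique up to isomorphism when $Y$ supports an ergodic invariant measure of full support) is the one through which every equicontinuous generic factor map factors via a factor map. *)

(* Defs.v *)
From HB Require Import structures.
From mathcomp Require Import all_boot all_order all_algebra.
From mathcomp Require Import all_classical all_reals all_analysis.
From mathcomp Require Import Rstruct Rstruct_topology.
Set Implicit Arguments. Unset Strict Implicit. Unset Printing Implicit Defensive.
Import Order.TTheory GRing.Theory Num.Theory.
Local Open Scope classical_set_scope.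
Local Open Scope ring_scope.

Notation R := Rdefinitions.R.

Definition Borel {T : topologicalType} : set (set T) := <<s open >>.

Definition borel_measure {T : topologicalType} (mu : set T -> \bar R) : Prop :=
  [/\ mu set0 = 0%E,
      (forall A, Borel A -> (0 <= mu A)%E) &
      (forall F : nat -> set T, (forall i, Borel (F i)) -> trivIset setT F ->
         (fun n => \sum_(0 <= i < n) mu (F i))%E @ \oo --> mu (\bigcup_n F n))].

Definition radon_measure {T : topologicalType} (mu : set T -> \bar R) : Prop :=
  [/\ borel_measure mu,
      (forall K, compact K -> (mu K < +oo)%E),
      (forall A, Borel A ->
         mu A = ereal_inf [set mu U | U in [set U | open U /\ A `<=` U]]) &
      (forall U, open U ->
         mu U = ereal_sup [set mu K | K in [set K | compact K /\ K `<=` U]])].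

Definition haar_measure {G : topologicalZmodType} (mu : set G -> \bar R) : Prop :=
  [/\ radon_measure mu, mu setT != 0%E &
      forall (g : G) A, Borel A -> mu [set g + x | x in A] = mu A].

Definition haar_probability {G : topologicalZmodType} (mu : set G -> \bar R) :=
  haar_measure mu /\ mu setT = 1%E.

Definition haar_aperiodic {H : topologicalZmodType} (mH : set H -> \bar R)
    (W : set H) : Prop :=
  forall h : H, let hW := [set h + w | w in W] in
    mH ((hW `\` W) `|` (W `\` hW)) = 0%E -> h = 0.

(* The torus Xh = (G x H)/L is given through its quotient map q :      *)
(* a continuous open surjective group homomorphism with kernel L       *)
(* (this characterizes the quotient topological group up to iso).      *)

Definition lcsc_abelian (G : topologicalZmodType) : Prop :=
  [/\ hausdorff_space G, locally_compact [set: G] & @second_countable G].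

Definition cocompact_lattice_quotient {G H Xh : topologicalZmodType}
    (L : set (G * H)) (q : G * H -> Xh) : Prop :=
  [/\ (forall x y, q (x + y) = q x + q y),
      continuous q /\ (forall U, open U -> open (q @` U)),
      (forall y, q y = 0 <-> L y) /\
        (exists U, nbhs (0 : G * H) U /\ U `&` L = [set 0]),
      q @` setT = setT &
      compact [set: Xh]].

Definition cut_and_project {G H Xh : topologicalZmodType}
    (L : set (G * H)) (q : G * H -> Xh) : Prop :=
  [/\ lcsc_abelian G, lcsc_abelian H, cocompact_lattice_quotient L q,
      {in L &, injective (@fst G H)} &
      closure [set y.2 | y in L] = setT].

Definition torus_action {G H Xh : topologicalZmodType} (q : G * H -> Xh)
  (g : G) (x : Xh) : Xh := q (g, 0) + x.

(* Locally finite measures with the vague topology, represented        *)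
(* (Riesz) as the functionals f |-> int f d mu on C_c(T), with the      *)
(* topology of pointwise convergence on C_c(T).                        *)

Definition is_Cc {T : topologicalType} (f : T -> R) : Prop :=
  continuous f /\ compact (closure [set x | f x != 0]).

Definition Cc (T : topologicalType) := {f : T -> R | is_Cc f}.

Definition Mspace (T : topologicalType) := {ptws Cc T -> R}.

(* f o t as an element of C_c (when it is one, which is always the case
   for the translations used below) *)
Definition Cc_comp {T : topologicalType} (t : T -> T) (f : Cc T) : Cc T :=
  match pselect (is_Cc (sval f \o t)) with
  | left h => exist _ (sval f \o t) h
  | right _ => f
  end.

Definition M_action {G H : topologicalZmodType} (g : G)
    (mu : Mspace (G * H)%type) : Mspace (G * H)%type :=
  fun f => mu (Cc_comp (fun y : G * H => y + (g, 0)) f).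

Definition MG_action {G : topologicalZmodType} (g : G)
    (mu : Mspace G) : Mspace G :=
  fun f => mu (Cc_comp (fun y : G => y + g) f).

(* nu_W(x) = sum of Dirac masses at the points of the coset x in G x W *)
Definition nu_W {G H Xh : topologicalZmodType} (q : G * H -> Xh) (W : set H)
    (x : Xh) : Mspace (G * H)%type :=
  fun f => (\sum_(y \in [set y : G * H | q y = x /\ W y.2]) sval f y)%R.

(* nu^G_W(x) = pi^G_* nu_W(x) *)
Definition nuG_W {G H Xh : topologicalZmodType} (q : G * H -> Xh) (W : set H)
    (x : Xh) : Mspace G :=
  fun f => (\sum_(y \in [set y : G * H | q y = x /\ W y.2]) sval f y.1)%R.

Definition push_meas {S T : Type} (mu : set S -> \bar R) (phi : S -> T) :
  set T -> \bar R := fun A => mu (phi @^-1` A).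

Definition top_support {T : topologicalType} (nu : set T -> \bar R) : set T :=
  [set t | forall U, open U -> U t -> (0 < nu U)%E].

Definition G_orbit {G T : Type} (act : G -> T -> T) (y : T) : set T :=
  [set act g y | g in setT].

Definition transitive_points {G : Type} {T : topologicalType}
    (act : G -> T -> T) (Y : set T) : set T :=
  [set y | Y y /\ closure (G_orbit act y) = Y].

Definition compatible_metric {Z : topologicalType} (d : Z -> Z -> R) : Prop :=
  [/\ (forall x y, d x y = 0 <-> x = y),
      (forall x y, d x y = d y x),
      (forall x y z, d x z <= d x y + d y z) &
      (forall A : set Z, open A <->
         forall x, A x -> exists2 e : R, 0 < e & [set y | d x y < e] `<=` A)].

Definition metrizable_space (Z : topologicalType) : Prop :=
  exists d : Z -> Z -> R, compatible_metric d.

Definition continuous_action {G : topologicalZmodType} {Z : topologicalType}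
    (act : G -> Z -> Z) : Prop :=
  [/\ (forall z, act 0 z = z),
      (forall g h z, act (g + h) z = act g (act h z)) &
      continuous (fun p : G * Z => act p.1 p.2)].

Definition minimal_action {G : Type} {Z : topologicalType} (act : G -> Z -> Z) :=
  forall z, closure (G_orbit act z) = setT.

Definition equicontinuous_action {G : Type} {Z : topologicalType}
    (act : G -> Z -> Z) : Prop :=
  forall d : Z -> Z -> R, compatible_metric d ->
  forall e : R, 0 < e -> exists2 delta : R, 0 < delta &
    forall x y, d x y < delta -> forall g, d (act g x) (act g y) < e.

Definition min_equicontinuous_system {G : topologicalZmodType} {Z : topologicalType}
    (act : G -> Z -> Z) : Prop :=
  [/\ continuous_action act, compact [set: Z] /\ hausdorff_space Z,
      metrizable_space Z, minimal_action act & equicontinuous_action act].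

Definition generic_factor_map {G : Type} {T Z : topologicalType}
    (actT : G -> T -> T) (Y : set T) (actZ : G -> Z -> Z) (phi : T -> Z) : Prop :=
  {within transitive_points actT Y, continuous phi} /\
  forall g y, transitive_points actT Y y -> phi (actT g y) = actZ g (phi y).

Definition factor_map {G : Type} {Z Z' : topologicalType}
    (actZ : G -> Z -> Z) (actZ' : G -> Z' -> Z') (pi : Z -> Z') : Prop :=
  [/\ continuous pi, pi @` setT = setT & forall g z, pi (actZ g z) = actZ' g (pi z)].

Definition max_equicontinuous_generic_factor {G : topologicalZmodType}
    {T Z : topologicalType} (actT : G -> T -> T) (Y : set T)
    (actZ : G -> Z -> Z) (phi : T -> Z) : Prop :=
  [/\ min_equicontinuous_system actZ,
      generic_factor_map actT Y actZ phi &
      forall (Z' : topologicalType) (actZ' : G -> Z' -> Z') (phi' : T -> Z'),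
        min_equicontinuous_system actZ' -> generic_factor_map actT Y actZ' phi' ->
        exists pi : Z -> Z', factor_map actZ actZ' pi /\
          forall y, transitive_points actT Y y -> phi' y = pi (phi y)].

(* Main.v *)
Require Import Defs.
From HB Require Import structures.
From mathcomp Require Import all_boot all_order all_algebra.
From mathcomp Require Import all_classical all_reals all_analysis.
From mathcomp Require Import Rstruct Rstruct_topology.
From mathcomp Require Import lra.
Set Implicit Arguments.
Unset Strict Implicit.
Unset Printing Implicit Defensive.
Import Order.TTheory GRing.Theory Num.Theory.
Import numFieldNormedType.Exports.
Local Open Scope classical_set_scope.
Local Open Scope ring_scope.

(** Let [E] be the closure of the graph [{(nu x, x)}] of the weak model sets
    inside (measures) x (torus).  As the torus is compact, every point of the
    support [Y] of the Mirsky measure has a lift in [E].  At a transitive point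
    the lift is unique: two lifts differ by a translation, which survives in
    the orbit closure, while some [nu x0] in [Y] has [x0] as its only lift.  So
    over the transitive points [E] is the graph of a continuous equivariant map
    to the torus.  In case (a) any [x0] whose coset meets [G x W] will do, since
    a single atom of [nu_W x0] determines the coset.  In case (b) take [x0]
    whose coset meets [G x (W n U)] for all open [U] with [mH (W n U) > 0],
    which holds almost everywhere; another lift of [nuG_W x0] would be its
    translate by some [(0, k)], and then [W] and [k + W] agree up to a null
    set.

    For maximality let [psi] be another equicontinuous generic factor map, and
    [a] the lift of a transitive point [y].  By Steinhaus' theorem for the sets
    [nu^-1 U], if the image of [g] in the torus is near [0] then [g] moves
    [psi y] only a little; hence [g + a |-> g (psi y)] is uniformly continuous
    on the dense orbit of [a] and extends to a factor map of the torus. *)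

(** * Separation, closed graphs and compactness *)

Lemma continuousR_distP (T : topologicalType) (f : T -> R) (x : T) :
  {for x, continuous f} <->
  forall e, 0 < e -> \forall y \near x, `|f x - f y| < e.
Proof. exact: (@cvgrPdist_lt R R^o T (nbhs x) _ f (f x)). Qed.

Lemma continuousR_cst (T : topologicalType) (c : R) : continuous (fun _ : T => c).
Proof. by move=> x; exact: (@cvg_cst R^o). Qed.

Lemma continuousRB (T : topologicalType) (f g : T -> R) :
  continuous f -> continuous g -> continuous (fun x => f x - g x).
Proof. by move=> cf cg x; exact: (@cvgB R R^o T (nbhs x) _ f g _ _ (cf x) (cg x)). Qed.

Lemma hausdorff_sepP (T : topologicalType) : hausdorff_space T -> forall x y : T,
  x <> y -> exists A B, [/\ open A, open B, A x, B y & A `&` B = set0].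
Proof.
rewrite open_hausdorff => hT x y /eqP xy; have [[A B] /= [xA yB] [oA oB /eqP AB]] := hT _ _ xy.
by exists A, B; split => //; exact: set_mem.
Qed.

Lemma hausdorff_of_sep (T : topologicalType) : (forall x y : T,
  x <> y -> exists A B, [/\ open A, open B, A x, B y & A `&` B = set0]) ->
  hausdorff_space T.
Proof.
move=> hT; rewrite open_hausdorff => x y /eqP /hT [A [B [oA oB Ax By AB]]].
by exists (A, B) => /=; split => //; [exact: mem_set|exact: mem_set|exact/eqP].
Qed.

(** The tube lemma: around each [(x, y)] with [y] in [K] a product neighbourhood misses [C], and
    compactness of [K] makes the neighbourhood of [x] uniform. *)
Lemma compact_avoid (X Y : topologicalType) (C : set (X * Y)) (K : set Y) (x : X) :
  closed C -> compact K -> (forall y, K y -> ~ C (x, y)) ->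
  \forall x' \near x, forall y, K y -> ~ C (x', y).
Proof.
move=> cC cK nC; have /compact_near_coveringP := cK.
move=> /(_ X (nbhs x) (fun x' y => ~ C (x', y)) _); apply => y Ky.
have : nbhs (x, y) (~` C).
  by apply: open_nbhs_nbhs; split; [exact: closed_openC|exact: nC].
case=> -[/= P Q] [xP yQ] PQ; exists (Q, P) => //= -[y' x'] /= [Qy Px].
exact: (PQ (x', y')).
Qed.

(** The complement of an open neighbourhood of [f x] is compact and [C] has no point over [x] in it;
    by [compact_avoid] the same holds over nearby points. *)
Lemma closed_graph_continuous (X Y : topologicalType) (C : set (X * Y))
    (S : set X) (f : X -> Y) :
  closed C -> compact [set: Y] -> (forall x, S x -> C (x, f x)) ->
  (forall x y, S x -> C (x, y) -> y = f x) -> {within S, continuous f}.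
Proof.
move=> cC cY Cf uC; apply/subspace_continuousP => x Sx O.
rewrite nbhsE => -[V [oV Vx] VO].
have cK : compact (~` V).
  by apply: subclosed_compact cY _ => //; exact: open_closedC.
have nC y : (~` V) y -> ~ C (x, y) by move=> nO /(uC _ _ Sx) e; apply: nO; rewrite e.
rewrite /nbhs /= /within /=; near=> x'; move=> Sx'; apply: VO; apply: contrapT => nO.
have H : forall y, (~` V) y -> ~ C (x', y).
  by near: x'; exact: compact_avoid.
exact: (H _ nO (Cf _ Sx')).
Unshelve. all: by end_near. Qed.

(** The projection along a compact factor is a closed map. This is the source of all lifts below. *)
Lemma closure_proj_lift (X Y : topologicalType) (A : set (X * Y)) (x : X) :
  compact [set: Y] -> closure [set p.1 | p in A] x ->
  exists y, closure A (x, y).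
Proof.
move=> cY cx; apply: contrapT => nE.
have : \forall x' \near x, forall y, [set: Y] y -> ~ closure A (x', y).
  apply: compact_avoid => //; first exact: closed_closure.
  by move=> y _ Ay; apply: nE; exists y.
move=> /cx [_ [[[a b] Aab <-]]] /(_ b Logic.I); apply; exact: subset_closure.
Qed.

Lemma eq_on_dense (X Z : topologicalType) (S D : set X) (f g : X -> Z) :
  hausdorff_space Z -> {within S, continuous f} -> {within S, continuous g} ->
  D `<=` S -> S `<=` closure D -> {in D, f =1 g} -> {in S, f =1 g}.
Proof.
move=> hZ /subspace_continuousP cf /subspace_continuousP cg DS SD fg x.
rewrite inE => Sx; apply: contrapT => /(hausdorff_sepP hZ) [A [B [oA oB Af Bg AB]]].
have nf : nbhs x [set y | S y -> A (f y)] := cf x Sx A (open_nbhs_nbhs (conj oA Af)).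
have ng : nbhs x [set y | S y -> B (g y)] := cg x Sx B (open_nbhs_nbhs (conj oB Bg)).
have [y [Dy [/(_ (DS _ Dy)) Ay /(_ (DS _ Dy)) By]]] := SD x Sx _ (filterI nf ng).
have : (A `&` B) (f y) by split => //; rewrite fg// inE.
by rewrite AB.
Qed.

Lemma continuous_compact_image (X Y : topologicalType) (f : X -> Y) (K : set X) :
  continuous f -> compact K -> compact (f @` K).
Proof. by move=> cf; apply: continuous_compact; exact: continuous_subspaceT. Qed.

(** * Countable bases and local compactness *)

Lemma countable_base_seq (T : topologicalType) : @second_countable T ->
  exists B : nat -> set T, (forall n, open (B n)) /\
    forall x U, nbhs x U -> exists2 n, B n x & B n `<=` U.
Proof.
case=> B /pfcard_geP cB [oB bB].
case: cB => [B0|/unsquash f].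
  exists (fun=> set0); split; first by move=> n; exact: open0.
  by move=> x U /bB [V [+ _]]; rewrite B0.
exists f; split; first by move=> n; apply: oB; exact: funS.
move=> x U /bB [V [BV Vx] VU]; have [n _ fn] := 'surj_f BV.
by exists n; rewrite fn.
Qed.

Lemma second_countable_of_seq (T : topologicalType) (B : nat -> set T) :
  (forall n, open (B n)) -> (forall x U, nbhs x U -> exists2 n, B n x & B n `<=` U) ->
  @second_countable T.
Proof.
move=> oB bB; exists (range B); first by apply: (sub_countable (card_image_le _ _)).
split; first by move=> _ [n _ <-].
by move=> x U /bB [n Bnx BnU]; exists (B n) => //; split => //; exists n.
Qed.

Lemma locally_compact_nbhs (T : topologicalType) (x : T) :
  locally_compact [set: T] -> exists K, [/\ nbhs x K, compact K & closed K].
Proof.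
by move=> /(_ x Logic.I); rewrite withinET => -[K xK [cK clK]]; exists K.
Qed.

Lemma locally_compact_base (T : topologicalType) :
  hausdorff_space T -> locally_compact [set: T] -> @second_countable T ->
  exists O : nat -> set T, [/\ forall n, open (O n),
    forall n, compact (closure (O n)) &
    forall x U, nbhs x U -> exists2 n, O n x & closure (O n) `<=` U].
Proof.
move=> hT lT /countable_base_seq [B [oB bB]].
(* Base members without compact closure are emptied; inside a small compact neighbourhood the
   remaining ones still form a base. *)
pose O n := if `[< compact (closure (B n)) >] then B n else set0.
exists O; split.
- by move=> n; rewrite /O; case: asboolP => _; [exact: oB|exact: open0].
- move=> n; rewrite /O; case: asboolP => [//|_].
  by rewrite closure0; exact: compact0.
- move=> x U xU; have [K [xK cK clK]] := locally_compact_nbhs x lT.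
  have [i xi iUK] := compact_regular hT cK xK (filterI xU xK).
  have [n Bx Bi] := bB _ _ xi.
  have cB : closure (B n) `<=` U `&` K by apply: subset_trans iUK; exact: closure_subset.
  have cpt : compact (closure (B n)).
    by apply: subclosed_compact cK _; [exact: closed_closure|move=> y /cB[]].
  have On : O n = B n by rewrite /O; case: asboolP.
  by exists n; rewrite On// => y /cB[].
Qed.

Lemma prod_hausdorff (G H : topologicalType) : hausdorff_space G ->
  hausdorff_space H -> hausdorff_space (G * H)%type.
Proof.
move=> hG hH; apply: hausdorff_of_sep => -[a b] [c d] ne.
have [ac|/(hausdorff_sepP hG) [A [B [oA oB Aa Bc AB]]]] := pselect (a = c).
  have /(hausdorff_sepP hH) [A [B [oA oB Aa Bc AB]]] : b <> d.
    by move=> bd; apply: ne; rewrite ac bd.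
  exists (snd @^-1` A), (snd @^-1` B); split => //.
  - by apply: open_comp => // x _; exact: cvg_snd.
  - by apply: open_comp => // x _; exact: cvg_snd.
  - by rewrite -preimage_setI AB preimage_set0.
exists (fst @^-1` A), (fst @^-1` B); split => //.
- by apply: open_comp => // x _; exact: cvg_fst.
- by apply: open_comp => // x _; exact: cvg_fst.
- by rewrite -preimage_setI AB preimage_set0.
Qed.

Lemma prod_locally_compact (G H : topologicalType) : hausdorff_space G ->
  hausdorff_space H -> locally_compact [set: G] -> locally_compact [set: H] ->
  locally_compact [set: (G * H)%type].
Proof.
move=> hG hH lG lH [a b] _; rewrite withinET.
have [K [aK cK _]] := locally_compact_nbhs a lG.
have [K' [bK cK' _]] := locally_compact_nbhs b lH.
exists (K `*` K'); first by exists (K, K').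
by split; [|apply: compact_closed; first exact: prod_hausdorff]; exact: compact_setX.
Qed.

Lemma prod_base (G H : topologicalType) (A : nat -> set G) (B : nat -> set H) :
  (forall x U, nbhs x U -> exists2 n, A n x & A n `<=` U) ->
  (forall x U, nbhs x U -> exists2 n, B n x & B n `<=` U) ->
  forall (x : G * H) U, nbhs x U ->
    exists2 n : nat * nat, (A n.1 `*` B n.2) x & A n.1 `*` B n.2 `<=` U.
Proof.
move=> bA bB [a b] U [[P Q] /= [aP bQ] PQ].
have [n An nP] := bA _ _ aP; have [m Bm mQ] := bB _ _ bQ.
by exists (n, m) => //= -[x y] [/= /nP ? /mQ ?]; exact: PQ.
Qed.

Lemma open_rect (G H : topologicalType) (A : set G) (B : set H) :
  open A -> open B -> open (A `*` B).
Proof.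
move=> oA oB; apply: openI.
  by apply: (@open_comp _ _ fst) => // x _; exact: cvg_fst.
by apply: (@open_comp _ _ snd) => // x _; exact: cvg_snd.
Qed.

Lemma prod_second_countable (G H : topologicalType) : @second_countable G ->
  @second_countable H -> @second_countable (G * H)%type.
Proof.
move=> /countable_base_seq [A [oA bA]] /countable_base_seq [B [oB bB]].
exists [set A n.1 `*` B n.2 | n in [set: nat * nat]].
  by apply: (sub_countable (card_image_le _ _)).
split.
  by move=> _ [[n m] _ <-]; exact: open_rect.
move=> x U /(prod_base bA bB) [n nx nU]; by exists (A n.1 `*` B n.2).
Qed.

(** The function is [1 - u], with [u] a Urysohn function that is [0] at [x] and [1] off the interior
    of [N] cut with a compact neighbourhood [K]; so its support stays in [K]. *)
Lemma Cc_bump (T : topologicalType) (x : T) (N : set T) :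
  hausdorff_space T -> locally_compact [set: T] -> nbhs x N ->
  exists f : Cc T, [/\ forall y, 0 <= sval f y, 0 < sval f x &
    forall y, ~ N y -> sval f y = 0].
Proof.
move=> hT lT xN; have [K [xK cK clK]] := locally_compact_nbhs x lT.
pose B := ~` (N `&` K)°.
have clB : closed B by apply: open_closedC; exact: open_interior.
have nBx : ~ B x by move=> /(_ (filterI xN xK)).
have sep := @locally_compact_completely_regular _ R lT hT _ _ clB nBx.
pose u : T -> R := Urysohn [set x] B.
have ux : u x = 0 by apply: (Urysohn_sub0 sep); exists x.
have uB y : B y -> u y = 1 by move=> By; apply: (Urysohn_sub1 sep); exists y.
have ur y : 0 <= u y <= 1.
  have := @Urysohn_range _ R [set x] B (u y) (ex_intro2 _ _ y Logic.I erefl).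
  by rewrite /= in_itv.
have NK y : 1 - u y != 0 -> (N `&` K) y.
  move=> uy; apply: interior_subset; apply: contrapT => /uB u1.
  by move: uy; rewrite u1 subrr eqxx.
have fCc : is_Cc (fun y => 1 - u y).
  split.
    by apply: continuousRB; [exact: continuousR_cst|exact: Urysohn_continuous].
  apply: (subclosed_compact (@closed_closure _ _) cK).
  by rewrite [X in _ `<=` X]((closure_id K).1 clK); apply: closure_subset => y /= /NK[].
exists (exist _ _ fCc) => /=; split.
- by move=> y; have := ur y; rewrite subr_ge0 => /andP[].
- by rewrite ux subr0.
- by move=> y nN; apply/eqP; apply: contrapT => /negP /NK [].
Qed.

(** The near-covering form of compactness is applied to the filter of finite index lists ordered by
    inclusion. *)
Lemma compact_finite_subcover (T : topologicalType) (I : eqType) (K : set T)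
    (f : I -> set T) :
  compact K -> (forall i, open (f i)) -> K `<=` \bigcup_i f i ->
  exists s : seq I, forall x, K x -> exists2 i, i \in s & f i x.
Proof.
move=> /compact_near_coveringP cK fo Kf.
pose F := [set A : set (seq I) | exists s0 : seq I, forall s : seq I, {subset s0 <= s} -> A s].
have FF : Filter F.
  split.
  - by exists [::].
  - move=> A B [s sA] [t tB]; exists (s ++ t) => r str; split.
      by apply: sA => i si; apply: str; rewrite mem_cat si.
    by apply: tB => i ti; apply: str; rewrite mem_cat ti orbT.
  - by move=> A B AB [s sA]; exists s => t /sA /AB.
have : F (fun s => K `<=` (fun x => exists2 i, i \in s & f i x)).
  apply: (cK _ F (fun s x => exists2 i, i \in s & f i x) FF) => x /Kf [i _ fix_].
  exists (f i, [set s | i \in s]) => /=; first split.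
  - by apply: open_nbhs_nbhs.
  - by exists [:: i] => s; apply; rewrite mem_head.
  - by move=> [y s] /= [fy si]; exists i.
by case=> s /(_ s) h; exists s => x Kx; apply: h.
Qed.

Lemma closure_sub_closed (T : topologicalType) (S F : set T) :
  closed F -> S `<=` F -> closure S `<=` F.
Proof.
move=> cF SF x cx; apply: cF => B /cx [y [Sy By]].
by exists y; split => //; exact: SF.
Qed.

(** * Topological groups *)

Section prod_topologicalZmod.
Variables G H : topologicalZmodType.

Lemma prod_sub_continuous :
  continuous (fun x : (G * H) * (G * H) => x.1 - x.2).
Proof.
have c1 : continuous (fun x : (G * H) * (G * H) => x.1.1 - x.2.1).
  move=> x; apply: (@continuous_comp _ _ _ (fun x : (G * H) * (G * H) => (x.1.1, x.2.1))
    (fun z : G * G => z.1 - z.2)); last exact: sub_continuous.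
  apply: cvg_pair; [apply: (@continuous_comp _ _ _ fst fst x)|
    apply: (@continuous_comp _ _ _ snd fst x)].
  - exact: cvg_fst.
  - exact: cvg_fst.
  - exact: cvg_snd.
  - exact: cvg_fst.
have c2 : continuous (fun x : (G * H) * (G * H) => x.1.2 - x.2.2).
  move=> x; apply: (@continuous_comp _ _ _ (fun x : (G * H) * (G * H) => (x.1.2, x.2.2))
    (fun z : H * H => z.1 - z.2)); last exact: sub_continuous.
  apply: cvg_pair; [apply: (@continuous_comp _ _ _ fst snd x)|
    apply: (@continuous_comp _ _ _ snd snd x)].
  - exact: cvg_fst.
  - exact: cvg_snd.
  - exact: cvg_snd.
  - exact: cvg_snd.
by move=> x; exact: (cvg_pair (c1 x) (c2 x)).
Qed.

(* Not a canonical instance: the one on products is already taken by the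
   topological modules. *)
Definition prod_group : topologicalZmodType :=
  HB.pack (G * H)%type
    (PreTopologicalNmodule_isTopologicalZmodule.Build (G * H)%type prod_sub_continuous).

End prod_topologicalZmod.

Section topological_group.
Variable G : topologicalZmodType.
Implicit Types (x y a : G) (U V : set G).

Lemma addl_continuous a : continuous (fun x : G => a + x).
Proof.
move=> x; apply: (@continuous_comp _ _ _ (fun x : G => (a, x)) (fun z : G * G => z.1 + z.2)).
  by apply: cvg_pair; [exact: cvg_cst|exact: cvg_id].
exact: add_continuous.
Qed.

Lemma addr_continuous a : continuous (fun x : G => x + a).
Proof.
move=> x; apply: (@continuous_comp _ _ _ (fun x : G => (x, a)) (fun z : G * G => z.1 + z.2)).
  by apply: cvg_pair; [exact: cvg_id|exact: cvg_cst].
exact: add_continuous.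
Qed.

Lemma translate_image a (A : set G) : [set a + x | x in A] = (fun x => - a + x) @^-1` A.
Proof.
apply/seteqP; split=> [_ [x Ax <-]|x /= Ax]; first by rewrite /= addKr.
by exists (- a + x) => //; rewrite addNKr.
Qed.

Lemma compact_translate a (K : set G) : compact K -> compact [set a + x | x in K].
Proof. by apply: continuous_compact_image; exact: addl_continuous. Qed.

Lemma nbhs_sub x V : nbhs 0 V -> nbhs x [set y | V (y - x)].
Proof. by move=> V0; apply: (@addr_continuous (- x) x); rewrite subrr. Qed.

Lemma nbhs_shift x V : nbhs x V -> nbhs 0 [set y | V (x + y)].
Proof. by move=> Vx; apply: (@addl_continuous x 0); rewrite addr0. Qed.

Lemma nbhs0_split U : nbhs 0 U ->
  exists V, nbhs 0 V /\ forall x y, V x -> V y -> U (x - y).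
Proof.
move=> U0; have : nbhs ((0, 0) : G * G) [set z | U (z.1 - z.2)].
  by apply: (@sub_continuous G (0, 0)); rewrite /= subrr.
case=> -[A B] /= [A0 B0] AB; exists (A `&` B); split; first exact: filterI.
by move=> x y [Ax _] [_ By]; exact: (AB (x, y)).
Qed.

Lemma compact_thicken (K O : set G) : compact K -> open O -> K `<=` O ->
  \forall t \near (0 : G), forall x, K x -> O (t + x).
Proof.
move=> /compact_near_coveringP cK oO KO; apply: (cK G (nbhs 0) (fun t x => O (t + x))).
move=> x Kx; have : nbhs ((x, 0) : G * G) [set z | O (z.1 + z.2)].
  apply: (@add_continuous G (x, 0)); rewrite /= addr0; apply: open_nbhs_nbhs.
  by split => //; exact: KO.
case=> -[A B] /= [A0 B0] AB; exists (A, B) => //= -[x' t] /= [Ax Bt].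
by rewrite addrC; exact: (AB (x', t)).
Qed.

End topological_group.

(** * The uniformity and the metric of a second countable group *)

Definition group_uniform (G : topologicalZmodType) : Type := G.

Section group_uniformity.
Variable G : topologicalZmodType.
Local Notation X := (group_uniform G).

HB.instance Definition _ := Topological.copy X G.

(** The translation uniformity. It is put on the alias [group_uniform], so that [G] keeps its own
    structures while the metrisation of countable uniformities becomes available. *)
Definition group_entourage : set_system (X * X) :=
  [set E | exists2 V : set G, nbhs (0 : G) V & forall x y : G, V (y - x) -> E (x, y)].

Lemma group_entourage_filter : Filter group_entourage.
Proof.
split.
- by exists setT => //; exact: filterT.
- move=> A B [V V0 VA] [U U0 UB]; exists (V `&` U); first exact: filterI.
  by move=> x y [Vx Uy]; split; [exact: VA|exact: UB].
- by move=> A B AB [V V0 VA]; exists V => // x y /VA /AB.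
Qed.

Local Open Scope relation_scope.

Lemma group_entourage_diagonal (A : set (X * X)) : group_entourage A -> diagonal `<=` A.
Proof.
move=> [V V0 VA] [x y]; rewrite /diagonal /= => xy; apply: VA; rewrite xy.
by rewrite subrr; exact: nbhs_singleton.
Qed.

Lemma group_entourage_inv (A : set (X * X)) : group_entourage A -> group_entourage A^-1.
Proof.
move=> [V V0 VA]; exists (-%R @^-1` V).
  by apply: opp_continuous; rewrite oppr0.
by move=> x y /=; rewrite opprB => /VA.
Qed.

Lemma group_entourage_split (A : set (X * X)) : group_entourage A ->
  exists2 B, group_entourage B & B \; B `<=` A.
Proof.
move=> [U /nbhs0_split [V [V0 VU]] UA].
exists [set z : X * X | V (z.2 - z.1 : G) /\ V (z.1 - z.2 : G)].
  exists (V `&` (-%R @^-1` V)).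
    by apply: filterI => //; apply: opp_continuous; rewrite oppr0.
  by move=> x y /= [Vx]; rewrite opprB.
move=> [x z] [y /= [_ V1] [V2 _]]; apply: UA.
have -> : (z : G) - x = (z - y) - (x - y) by rewrite opprB addrA subrK.
exact: VU.
Qed.

Lemma group_nbhsE : @nbhs X X = nbhs_ group_entourage.
Proof.
apply/funext => x; apply/seteqP; split=> A.
  move=> xA; exists [set z | A (z.2 - z.1 + x : G)].
    exists [set y : G | A (x + y)]; first exact: nbhs_shift.
    by move=> y z /=; rewrite addrC.
  by move=> y /set_mem /=; rewrite subrK.
move=> [E [V V0 VE] EA].
have := @nbhs_sub G x V V0; apply: filterS => y /= Vy.
by apply: EA; apply/mem_set; exact: VE.
Qed.

HB.instance Definition _ := Nbhs_isUniform.Build X group_entourage_filter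
  group_entourage_diagonal group_entourage_inv group_entourage_split group_nbhsE.

End group_uniformity.

Section group_metric.
Variable G : topologicalZmodType.
Hypotheses (hG : hausdorff_space G) (scG : @second_countable G).
Local Notation X := (group_uniform G).

Lemma group_countable_uniformity : countable_uniformity X.
Proof.
have [B [oB bB]] := countable_base_seq scG; apply/countable_uniformityP.
(* Base members that miss [0] give no entourage; the full relation stands in for them. *)
exists (fun n => if `[< B n 0 >] then [set z : X * X | B n (z.2 - z.1 : G)] else setT).
  move=> A [V V0 VA]; have [n Bn BV] := bB _ _ V0; exists n.
  by rewrite asboolT// => -[x y] /= /BV /VA.
move=> n; case: asboolP => Bn; last exact: entourageT.
by exists (B n) => //; apply: open_nbhs_nbhs.
Qed.

Local Notation M := (countable_uniform group_countable_uniformity).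

(** The metrisation yields a bounded metric, so by [group_edist_fin] the extended distance is finite
    and [fine] loses nothing. *)
Definition group_dist (x y : G) : R := fine (@edist R M (x, y)).

Lemma group_edist_fin (x y : G) : @edist R M (x, y) \is a fin_num.
Proof.
apply/edist_finP; exists 2 => //.
exact: countable_uniform.countable_uniform_bounded.
Qed.

Lemma group_dist_lt_ball (x y : G) e : group_dist x y < e -> @ball R M x e y.
Proof.
move=> de; apply: (@edist_lt_ball R M e (x, y)).
by rewrite -[edist _]fineK ?lte_fin//; exact: group_edist_fin.
Qed.

Lemma group_dist_le_ball (x y : G) e : 0 < e -> @ball R M x e y -> group_dist x y <= e.
Proof.
move=> e0 b; rewrite -lee_fin fineK; last exact: group_edist_fin.
exact: (@edist_fin R M e (x, y)).
Qed.

Lemma group_compatible_metric : compatible_metric group_dist.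
Proof.
have nb (x : G) (A : set G) : nbhs x A <->
    exists2 e : R, 0 < e & [set y | group_dist x y < e] `<=` A.
  split=> [xA|[e e0 eA]].
    have /(@nbhs_ballP R M) [e e0 eA] : @nbhs M M x A by [].
    by exists e => // y /= h; apply: eA; exact: group_dist_lt_ball.
  suff : @nbhs M M x A by [].
  (* The radius is halved because membership in a ball only bounds [group_dist] by the radius
     non-strictly. *)
  apply/(@nbhs_ballP R M); exists (e / 2); first by rewrite /= divr_gt0.
  move=> y b; have le : group_dist x y <= e / 2.
    by apply: group_dist_le_ball => //; rewrite divr_gt0.
  apply: eA => /=.
  by rewrite (le_lt_trans le)// ltr_pdivrMr// ltr_pMr// ltr1n.
split.
- move=> x y; split=> [d0|->]; last by rewrite /group_dist edist_refl.
  apply: contrapT => /(hausdorff_sepP hG) [A [B [oA oB Ax By AB]]].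
  have /nb [e e0 eA] : nbhs x A by apply: open_nbhs_nbhs.
  have : (A `&` B) y by split => //; apply: eA; rewrite /= d0.
  by rewrite AB.
- by move=> x y; rewrite /group_dist edist_sym.
- move=> x y z; rewrite /group_dist -fineD; [|exact: group_edist_fin..].
  apply: fine_le; [exact: group_edist_fin| |exact: edist_triangle].
  by rewrite fin_numD !group_edist_fin.
- move=> A; rewrite openE; split=> [oA x /oA /nb//|oA x /oA /nb//].
Qed.

Lemma group_metrizable : metrizable_space G.
Proof. by exists group_dist; exact: group_compatible_metric. Qed.

End group_metric.

(** * Compatible metrics *)

Section compatible_metric_facts.
Variables (Z : topologicalType) (d : Z -> Z -> R).
Hypothesis cd : compatible_metric d.

Lemma cmetric_refl x : d x x = 0.
Proof. by have [+ _ _ _] := cd => ->. Qed.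

Lemma cmetric_sym x y : d x y = d y x.
Proof. by have [_ + _ _] := cd. Qed.

Lemma cmetric_tri x y z : d x z <= d x y + d y z.
Proof. by have [_ _ + _] := cd. Qed.

Lemma cmetric_ge0 x y : 0 <= d x y.
Proof.
have := cmetric_tri x y x; rewrite cmetric_refl (cmetric_sym y x) -mulr2n.
by rewrite pmulrn_lge0.
Qed.

Lemma cmetric_ball_open x e : open [set y | d x y < e].
Proof.
have [_ _ _ op] := cd; apply/op => y /= dxy; exists (e - d x y); first by rewrite subr_gt0.
move=> z /=; rewrite ltrBrDl => dz; exact: le_lt_trans (cmetric_tri x y z) dz.
Qed.

Lemma cmetric_nbhs x e : 0 < e -> nbhs x [set y | d x y < e].
Proof.
move=> e0; apply: open_nbhs_nbhs; split; first exact: cmetric_ball_open.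
by rewrite /= cmetric_refl.
Qed.

Lemma cmetric_continuous : continuous (fun z : Z * Z => d z.1 z.2).
Proof.
move=> [x y]; apply/continuousR_distP => e e0 /=.
have e2 : 0 < e / 2 by rewrite divr_gt0.
exists ([set x' | d x x' < e / 2], [set y' | d y y' < e / 2]) => /=.
  by split; exact: cmetric_nbhs.
move=> [x' y'] /= [dx dy].
have := cmetric_tri x x' y; have := cmetric_tri x' y' y.
have := cmetric_tri x' x y'; have := cmetric_tri x y y'.
rewrite (cmetric_sym x' x) (cmetric_sym y' y) ltr_norml => h1 h2 h3 h4.
by apply/andP; split; lra.
Qed.

End compatible_metric_facts.

(** * Borel sets and Borel measures *)

Section Borel_sets.
Variable T : topologicalType.
Implicit Types A B : set T.

Lemma Borel_open A : open A -> Borel A.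
Proof. by move=> oA; exact: sub_sigma_algebra. Qed.

Lemma BorelC A : Borel A -> Borel (~` A).
Proof. by move=> bA; rewrite -setTD; exact: sigma_algebraCD. Qed.

Lemma Borel_closed A : closed A -> Borel A.
Proof. by move=> cA; rewrite -[A]setCK; apply: BorelC; apply: Borel_open; exact: closed_openC. Qed.

Lemma Borel0 : Borel (@set0 T).
Proof. exact: sigma_algebra0. Qed.

Lemma BorelT : Borel [set: T].
Proof. by apply: Borel_open; exact: openT. Qed.

Lemma Borel_bigcup (F : nat -> set T) : (forall n, Borel (F n)) -> Borel (\bigcup_n F n).
Proof. exact: sigma_algebra_bigcup. Qed.

Lemma Borel_bigcap (F : nat -> set T) : (forall n, Borel (F n)) -> Borel (\bigcap_n F n).
Proof.
move=> bF; rewrite -[X in Borel X]setCK setC_bigcap; apply: BorelC.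
by apply: Borel_bigcup => n; exact: BorelC.
Qed.

Lemma BorelU A B : Borel A -> Borel B -> Borel (A `|` B).
Proof.
by move=> bA bB; rewrite -bigcup2E; apply: Borel_bigcup => -[|[|n]] //=; exact: Borel0.
Qed.

Lemma BorelI A B : Borel A -> Borel B -> Borel (A `&` B).
Proof.
by move=> bA bB; rewrite -[X in Borel X]setCK setCI; apply: BorelC; apply: BorelU; exact: BorelC.
Qed.

Lemma BorelD A B : Borel A -> Borel B -> Borel (A `\` B).
Proof. by move=> bA bB; apply: BorelI => //; exact: BorelC. Qed.

Lemma Borel_compact A : hausdorff_space T -> compact A -> Borel A.
Proof. by move=> hT cA; apply: Borel_closed; exact: compact_closed. Qed.

End Borel_sets.

Lemma Borel_ind (T : topologicalType) (P : set (set T)) :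
  (forall A, open A -> P A) -> (forall A, P A -> P (~` A)) ->
  (forall F : nat -> set T, (forall n, P (F n)) -> P (\bigcup_n F n)) ->
  forall A, Borel A -> P A.
Proof.
move=> oP cP uP; apply: smallest_sub => //; split => //.
- by apply: oP; exact: open0.
- by move=> A PA; rewrite setTD; exact: cP.
Qed.

Lemma Borel_preimage (S T : topologicalType) (f : S -> T) (B : set T) :
  continuous f -> Borel B -> Borel (f @^-1` B).
Proof.
move=> cf; apply: (@Borel_ind _ [set B | Borel (f @^-1` B)]) => /=.
- by move=> A oA; apply: Borel_open; apply: open_comp => // x _; exact: cf.
- by move=> A bA; rewrite preimage_setC; exact: BorelC.
- by move=> F bF; rewrite preimage_bigcup; exact: Borel_bigcup.
Qed.

(** An alias that carries the Borel sets as a measurable structure, so that integration theory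
    applies to the set functions of the statement. *)
Definition borel_space (T : topologicalZmodType) : Type := T.

Section borel_space_instances.
Variable T : topologicalZmodType.

HB.instance Definition _ := Choice.copy (borel_space T) T.
HB.instance Definition _ := isPointed.Build (borel_space T) (0 : T).
HB.instance Definition _ := @isMeasurable.Build (sigma_display (@open T))
  (borel_space T) (@Borel T) (@Borel0 T) (@BorelC T) (@Borel_bigcup T).

End borel_space_instances.

(* [borel_measure] says nothing about non-Borel sets, where a measure of the
   library must still be nonnegative; hence the truncation at [0]. *)
Definition measure_of (T : topologicalZmodType) (mu : set T -> \bar R)
  of borel_measure mu : set (borel_space T) -> \bar R := fun A => maxe 0%E (mu A).

Section measure_of_instance.
Variables (T : topologicalZmodType) (mu : set T -> \bar R) (bmu : borel_measure mu).

Lemma measure_ofE (A : set T) : Borel A -> measure_of bmu A = mu A.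
Proof. by move=> bA; rewrite /measure_of max_r//; case: bmu => _ + _; exact. Qed.

Let measure_of0 : measure_of bmu set0 = 0%E.
Proof.
by rewrite (measure_ofE (@Borel0 T)); have [m0 _ _] := bmu.
Qed.

Let measure_of_ge0 (A : set (borel_space T)) : (0 <= measure_of bmu A)%E.
Proof. by rewrite /measure_of le_max lexx. Qed.

Let measure_of_additive : semi_sigma_additive (measure_of bmu).
Proof.
move=> F mF tF mUF; have [_ _ /(_ F mF tF)] := bmu; rewrite (measure_ofE mUF).
rewrite (_ : (fun n => \sum_(0 <= i < n) mu (F i))%E =
  (fun n => \sum_(0 <= i < n) measure_of bmu (F i))%E)//.
by apply/funext => n; apply: eq_bigr => i _; rewrite (measure_ofE (mF i)).
Qed.

HB.instance Definition _ := isMeasure.Build _ (borel_space T) R (measure_of bmu)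
  measure_of0 measure_of_ge0 measure_of_additive.

Lemma borel_measure_ge0 A : Borel A -> (0 <= mu A)%E.
Proof. by case: bmu => _ + _; exact. Qed.

Lemma le_borel_measure A B : Borel A -> Borel B -> A `<=` B -> (mu A <= mu B)%E.
Proof.
by move=> bA bB AB; rewrite -!measure_ofE//; apply: le_measure => //; rewrite inE.
Qed.

Lemma borel_measureU A B : Borel A -> Borel B -> A `&` B = set0 ->
  mu (A `|` B) = (mu A + mu B)%E.
Proof.
by move=> bA bB AB; rewrite -!measure_ofE//; [exact: measureU|exact: BorelU].
Qed.

Lemma borel_measure_bigcup0 (F : nat -> set T) : (forall n, Borel (F n)) ->
  (forall n, mu (F n) = 0%E) -> mu (\bigcup_n F n) = 0%E.
Proof.
move=> bF F0; rewrite -measure_ofE; last exact: Borel_bigcup.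
have : (measure_of bmu).-negligible (\bigcup_n F n).
  apply: negligible_bigcup => n; exists (F n); split => //.
    exact: bF.
  exact: etrans (measure_ofE (bF n)) (F0 n).
by move=> /negligibleP; apply; exact: Borel_bigcup.
Qed.

Lemma borel_measureDI A B : Borel A -> Borel B ->
  mu A = (mu (A `\` B) + mu (A `&` B))%E.
Proof.
move=> bA bB; rewrite -borel_measureU; [|exact: BorelD|exact: BorelI|].
  by rewrite setUC setUIDK.
by rewrite setDE setIACA setICl setI0.
Qed.

End measure_of_instance.

(** The same function as [measure_of]; taking the finiteness proof as an argument gives a head
    symbol to which the finite measure structure can be attached. *)
Definition finite_measure_of (T : topologicalZmodType) (mu : set T -> \bar R)
  (bmu : borel_measure mu) of (mu setT < +oo)%E : set (borel_space T) -> \bar R :=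
  measure_of bmu.

Section finite_measure_of_instance.
Variables (T : topologicalZmodType) (mu : set T -> \bar R) (bmu : borel_measure mu).
Hypothesis fmu : (mu setT < +oo)%E.
Local Notation m := (finite_measure_of bmu fmu).

HB.instance Definition _ := isMeasure.Build _ (borel_space T) R m
  (@measure0 _ _ _ (measure_of bmu)) (@measure_ge0 _ _ _ (measure_of bmu))
  (@measure_semi_sigma_additive _ _ _ (measure_of bmu)).

Let finite_measure_of_fin : fin_num_fun m.
Proof.
move=> A mA; rewrite ge0_fin_numE; last exact: measure_ge0.
rewrite /finite_measure_of (measure_ofE bmu mA); apply: le_lt_trans fmu.
by apply: le_borel_measure => //; exact: BorelT.
Qed.

HB.instance Definition _ := Measure_isFinite.Build _ (borel_space T) R m
  finite_measure_of_fin.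

End finite_measure_of_instance.

(** Second countability makes every open set of the product a countable union of open rectangles, so
    the product sigma-algebra contains the Borel sets. *)
Lemma Borel_prod_measurable (X Y : topologicalZmodType) (E : set (X * Y)) :
  @second_countable X -> @second_countable Y -> Borel E ->
  measurable (E : set (borel_space X * borel_space Y)).
Proof.
move=> /countable_base_seq [A [oA bA]] /countable_base_seq [B [oB bB]].
apply: (@Borel_ind _ [set E | measurable (E : set (borel_space X * borel_space Y))]) => /=.
- move=> O oO.
  pose F (n : nat * nat) : set (X * Y) :=
    if `[< A n.1 `*` B n.2 `<=` O >] then A n.1 `*` B n.2 else set0.
  have -> : O = \bigcup_n F n.
    apply/seteqP; split=> [z Oz|z [n _]]; last first.
      by rewrite /F; case: asboolP => // nO /nO.
    have /(prod_base bA bB) [n nz nO] : nbhs z O by apply: open_nbhs_nbhs.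
    by exists n => //; rewrite /F asboolT.
  apply: (@countable_bigcupT_measurable _ (borel_space X * borel_space Y)%type _ F) => //.
  move=> n; rewrite /F; case: asboolP => _; last exact: measurable0.
  by apply: measurableX; apply: Borel_open.
- by move=> E' mE; exact: measurableC.
- by move=> F mF; exact: bigcupT_measurable.
Qed.

(** * Fubini for null sets *)

Section fubini_null.
Variables (X Y : topologicalZmodType) (mu : set X -> \bar R) (nu : set Y -> \bar R).
Hypotheses (bmu : borel_measure mu) (bnu : borel_measure nu).
Hypotheses (fmu : (mu setT < +oo)%E) (fnu : (nu setT < +oo)%E).
Hypotheses (scX : @second_countable X) (scY : @second_countable Y).

(** By Tonelli the integral of the measures of the vertical sections is that of the horizontal ones,
    hence [0]. So almost every vertical section is null, and [B] is too large to miss them all. *)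
Lemma fubini_null (E : set (X * Y)) (B : set X) : Borel E ->
  (forall y, mu [set x | E (x, y)] = 0%E) -> Borel B -> (0 < mu B)%E ->
  exists2 x, B x & nu [set y | E (x, y)] = 0%E.
Proof.
move=> bE E0 bB B0; apply: contrapT => nex.
pose m1 : {finite_measure set (borel_space X) -> \bar R} := finite_measure_of bmu fmu.
pose m2 : {finite_measure set (borel_space Y) -> \bar R} := finite_measure_of bnu fnu.
have mE := Borel_prod_measurable scX scY bE.
have m1E (A : set X) : Borel A -> m1 A = mu A by exact: (measure_ofE bmu).
have m2E (A : set Y) : Borel A -> m2 A = nu A by exact: (measure_ofE bnu).
have xE x : xsection (E : set (borel_space X * borel_space Y)) x = [set y | E (x, y)].
  by apply/seteqP; split=> y; rewrite /xsection /= inE.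
have yE y : ysection (E : set (borel_space X * borel_space Y)) y = [set x | E (x, y)].
  by apply/seteqP; split=> x; rewrite /ysection /= inE.
have bxE x : Borel [set y | E (x, y)].
  by have := measurable_xsection (x : borel_space X) mE; rewrite xE.
have byE y : Borel [set x | E (x, y)].
  by have := measurable_ysection (y : borel_space Y) mE; rewrite yE.
have := indic_fubini_tonelli m1 m2 mE.
rewrite (indic_fubini_tonelli_FE m2 mE) (indic_fubini_tonelli_GE m1 mE) /=.
rewrite [X in _ = X](_ : _ = 0%E); last first.
  by apply: integral0_eq => y _; rewrite yE m1E.
have mf := measurable_fun_xsection m2 mE.
rewrite (eq_integral (fun x =>
  `|(m2 \o xsection (E : set (borel_space X * borel_space Y))) x|%E)); last first.
  by move=> x _; rewrite gee0_abs.
move=> /(ae_eq_integral_abs m1 measurableT mf) [N [mN N0 EN]].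
have : (mu B <= mu N)%E.
  apply: le_borel_measure => // x Bx; apply: EN => /= h; apply: nex; exists x => //.
  by rewrite -m2E// -xE; exact: h.
by rewrite -(m1E N)// N0 leNgt B0.
Qed.

End fubini_null.

(** * Haar measure on a compact group: Steinhaus and ergodicity *)

Lemma haar_preimage (G : topologicalZmodType) (mu : set G -> \bar R) (a : G) (A : set G) :
  haar_measure mu -> Borel A -> mu [set x | A (a + x)] = mu A.
Proof.
by move=> [_ _ hm] bA; rewrite -(hm (- a) A bA) translate_image opprK.
Qed.

Lemma Borel_shift (G : topologicalZmodType) (a : G) (A : set G) :
  Borel A -> Borel [set x | A (a + x)].
Proof.
by move=> bA; apply: (@Borel_preimage _ _ (fun x => a + x)) => //; exact: addl_continuous.
Qed.

Section compact_haar.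
Variables (X : topologicalZmodType) (m : set X -> \bar R).
Hypotheses (hX : hausdorff_space X) (cX : compact [set: X]) (scX : @second_countable X).
Hypothesis hm : haar_probability m.

Let bm : borel_measure m. Proof. by case: hm => -[[]]. Qed.
Let mT : m setT = 1%E. Proof. by case: hm. Qed.
Let hh : haar_measure m. Proof. by case: hm. Qed.
Let outer (A : set X) : Borel A ->
  m A = ereal_inf [set m U | U in [set U | open U /\ A `<=` U]].
Proof. by case: hm => -[[_ _ + _] _ _ _]; exact. Qed.

Lemma haar_fin (A : set X) : Borel A -> m A \is a fin_num.
Proof.
move=> bA; rewrite ge0_fin_numE; last exact: borel_measure_ge0.
apply: (@le_lt_trans _ _ 1%E); last exact: ltry.
by rewrite -mT; apply: le_borel_measure => //; exact: BorelT.
Qed.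

(** Outer regularity of the complement: an open set containing it with measure below [1] has a
    compact complement inside [A]. *)
Lemma haar_inner (A : set X) : Borel A -> (0 < m A)%E ->
  exists K, [/\ compact K, K `<=` A & (0 < m K)%E].
Proof.
move=> bA A0; have bC := BorelC bA.
have split1 B : Borel B -> (m B + m (~` B) = 1)%E.
  move=> bB; rewrite -(borel_measureU bm)//; [|exact: BorelC|exact: setICr].
  by rewrite setUv.
have : (m (~` A) < 1)%E by rewrite -(split1 A bA) lteDr//; exact: haar_fin.
rewrite outer// => /ereal_inf_lt [_ [U [oU AU] <-] U1].
exists (~` U); split.
- by apply: (subclosed_compact _ cX) => //; exact: open_closedC.
- by move=> x nU; apply: contrapT => /AU.
- have bU := Borel_open oU; move: U1; rewrite -(split1 U bU) lteDl//.
  exact: haar_fin.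
Qed.

(** Take a compact [K] in [A] of positive measure and an open [U] containing [K] with measure below
    twice that of [K]. A small translate of [K] stays in [U], so it cannot be disjoint from [K] up
    to a null set. *)
Lemma haar_steinhaus (A : set X) : Borel A -> (0 < m A)%E ->
  \forall t \near (0 : X), (0 < m (A `&` [set x | A (t + x)%R]))%E.
Proof.
move=> bA /(haar_inner bA) [K [cK KA K0]].
have bK : Borel K by exact: Borel_compact.
have fK := haar_fin bK.
have : (m K < m K + m K)%E by rewrite lteDr.
rewrite {1}outer// => /ereal_inf_lt [_ [U [oU KU] <-] UK].
have : \forall t \near (0 : X), forall x, K x -> U (- t + x).
  have := @opp_continuous X 0 [set t | forall x, K x -> U (t + x)].
  by apply; rewrite oppr0; exact: compact_thicken.
apply: filterS => t tU.
have bK' := @Borel_shift X t K bK.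
have bI := BorelI bK bK'.
apply: (@lt_le_trans _ _ (m (K `&` [set x | K (t + x)]))); last first.
  apply: le_borel_measure => //; first by apply: BorelI => //; exact: Borel_shift.
  by move=> x [Kx Kt]; split; exact: KA.
rewrite lt0e borel_measure_ge0// andbT; apply/negP => /eqP I0.
have : (m K + m K <= m U)%E.
  rewrite {1}(borel_measureDI bm bK bK') I0 adde0 -(@haar_preimage _ _ t K hh bK).
  rewrite -(borel_measureU bm)//; [|exact: BorelD|by rewrite setDKI].
  apply: le_borel_measure => //; [by apply: BorelU => //; exact: BorelD|exact: Borel_open|].
  move=> x [[/KU]//|/= Kx]; by rewrite -(addKr t x); exact: tU.
by rewrite leNgt UK.
Qed.

(** Some translation [t0] works: otherwise Fubini would give an [x] for which the translate of [B]
    by [- x] is null. Steinhaus then moves [t0] into the dense set [D]. *)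
Lemma haar_ergodic (A B D : set X) : Borel A -> Borel B -> (0 < m A)%E -> (0 < m B)%E ->
  closure D = setT -> exists2 t, D t & (0 < m (A `&` [set x | B (t + x)%R]))%E.
Proof.
move=> bA bB A0 B0 dD.
have bAB t : Borel (A `&` [set x | B (t + x)]) by apply: BorelI => //; exact: Borel_shift.
have [t0 t0P] : exists t, (0 < m (A `&` [set x | B (t + x)%R]))%E.
  apply: contrapT => nt.
  have fm : (m setT < +oo)%E by rewrite mT ltry.
  pose E := [set z : X * X | A z.1 /\ B (z.2 + z.1)].
  have bE : Borel E.
    apply: BorelI.
      by apply: (@Borel_preimage _ _ fst) => // z; exact: cvg_fst.
    apply: (@Borel_preimage _ _ (fun z : X * X => z.2 + z.1)) => //.
    rewrite (_ : (fun z : X * X => z.2 + z.1) = (fun z => z.1 + z.2)); first exact: add_continuous.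
    by apply/funext => z; rewrite addrC.
  have E0 t : m [set x | E (x, t)] = 0%E.
    apply/eqP; rewrite eq_le borel_measure_ge0//; last exact: bAB.
    by rewrite andbT leNgt; apply/negP => h; apply: nt; exists t.
  have [x Ax] := fubini_null bm bm fm fm scX scX bE E0 bA A0.
  rewrite (_ : [set y | E (x, y)] = [set y | B (x + y)]); last first.
    by apply/seteqP; split=> y /=; rewrite /E/= addrC => // -[].
  by rewrite haar_preimage// => B00; rewrite B00 ltxx in B0.
pose C := A `&` [set x | B (t0 + x)].
have sC : \forall s \near (0 : X), (0 < m (C `&` [set x | C (s + x)%R]))%E.
  exact: haar_steinhaus (bAB t0) t0P.
have : nbhs t0 [set t | (0 < m (C `&` [set x | C ((t - t0) + x)%R]))%E] by exact: (nbhs_sub t0 sC).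
have : closure D t0 by rewrite dD.
move=> /[apply] -[t [Dt /= tP]]; exists t => //; apply: lt_le_trans tP _.
apply: le_borel_measure => //.
  by apply: BorelI; [exact: bAB|exact: (Borel_shift (t - t0) (bAB t0))].
move=> x [[Ax _] [_ /=]]; rewrite addrA addrC addrA addrAC addrA subrK addrC => Bt.
by split => //=; rewrite addrC.
Qed.

Lemma haar_open_pos (O : set X) x : open O -> O x -> (0 < m O)%E.
Proof.
move=> oO Ox; have bO := Borel_open oO.
rewrite lt0e borel_measure_ge0// andbT; apply/negP => /eqP O0.
have fo a : open [set y | O (x - a + y)].
  by apply: (@open_comp _ _ (fun y => x - a + y)) => // y _; exact: addl_continuous.
have [s sP] : exists s : seq X, forall y, [set: X] y ->
    exists2 a, a \in s & [set y | O (x - a + y)] y.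
  by apply: compact_finite_subcover => // y _; exists y => //=; rewrite subrK.
(* Past the end of [s] the default [0] of [nth] only adds one more translate of [O], which is null
   as well. *)
have : m (\bigcup_n [set y | O (x - nth 0 s n + y)]) = 0%E.
  apply: (borel_measure_bigcup0 bm) => n; first exact: Borel_open.
  by rewrite haar_preimage.
rewrite (_ : \bigcup_n _ = setT); last first.
  apply/seteqP; split=> // y _; have [a sa Oa] := sP y Logic.I.
  by exists (index a s) => //=; rewrite nth_index.
by rewrite mT => /eqP; rewrite onee_eq0.
Qed.

End compact_haar.

(** * Rotations of a compact group *)

Section rotation.
Variables (G X : topologicalZmodType) (iota : G -> X).
Hypotheses (hX : hausdorff_space X) (cX : compact [set: X]) (scX : @second_countable X).
Hypotheses (iotaD : forall g h, iota (g + h) = iota g + iota h)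
  (iota_cont : continuous iota) (iota_dense : closure (range iota) = setT).

Let iota0 : iota 0 = 0.
Proof. by apply: (addrI (iota 0)); rewrite -iotaD !addr0. Qed.

(** The metric [d] is arbitrary and may fail to be invariant. The pairs at distance at least [e] are
    therefore saturated under diagonal translation to [K']; it is still compact and off the
    diagonal, so [d] is bounded below on it. *)
Lemma rotation_equicontinuous :
  equicontinuous_action (fun (g : G) (x : X) => iota g + x).
Proof.
move=> d cd e e0; have cXX : compact [set: (X * X)%type].
  by rewrite -setXTT; exact: compact_setX.
pose K := [set z : X * X | e <= d z.1 z.2].
have cK : compact K.
  apply: (subclosed_compact _ cXX) => //.
  apply: (@closed_comp _ _ (fun z : X * X => d z.1 z.2) [set r : R | e <= r]).
    by move=> z _; exact: cmetric_continuous.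
  exact: (@closed_ge R e).
pose D := (fun z : X * X => z.1 - z.2) @` K.
have cD : compact D by apply: continuous_compact_image => //; exact: sub_continuous.
pose K' := (fun z : X * X => z.1 - z.2) @^-1` D.
have cK' : compact K'.
  apply: (subclosed_compact _ cXX) => //.
  apply: closed_comp => [z _|]; first exact: sub_continuous.
  exact: compact_closed.
have [K'0|/set0P K'0] := eqVneq K' set0.
  exists 1 => // x y _ g; rewrite ltNge; apply/negP => ed.
  have : K' (iota g + x, iota g + y) by exists (iota g + x, iota g + y).
  by rewrite K'0.
have pos z : K' z -> 0 < d z.1 z.2.
  move=> [w Kw wz]; rewrite lt0r (cmetric_ge0 cd) andbT; apply/negP => /eqP.
  have [d0 _ _ _] := cd; move=> /d0 z12; move: wz; rewrite z12 subrr.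
  move=> /eqP; rewrite subr_eq0 => /eqP w12; move: Kw; rewrite /K /= w12 (cmetric_refl cd).
  by rewrite leNgt e0.
(* The open sets where [d] exceeds [1 / (n + 1)] cover [K']; the largest index of a finite subcover
   gives [delta]. *)
have [delta d0 dP] : exists2 delta, 0 < delta & forall z, K' z -> delta <= d z.1 z.2.
  pose I (n : nat) : set (X * X) := [set z | n.+1%:R^-1 < d z.1 z.2].
  have [s sP] : exists s : seq nat, forall z, K' z -> exists2 n, n \in s & I n z.
    apply: compact_finite_subcover => //.
      move=> n; apply: (@open_comp _ _ (fun z : X * X => d z.1 z.2) [set r : R | n.+1%:R^-1 < r]).
        by move=> z _; exact: cmetric_continuous.
      exact: (@open_gt R).
    move=> z /pos dz; have [n nd] : exists n : nat, (d z.1 z.2)^-1 < n.+1%:R.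
      by exists (Num.truncn (d z.1 z.2)^-1); rewrite truncnS_gt.
    by exists n => //; rewrite /I /= -[X in _ < X]invrK ltf_pV2// posrE ?invr_gt0.
  pose N := \max_(n <- s) n.
  exists N.+1%:R^-1; first by rewrite invr_gt0.
  move=> z /sP [n ns nz]; apply: le_trans (ltW nz).
  by rewrite lef_pV2 ?posrE// ler_nat ltnS /N; exact: leq_bigmax_seq.
exists delta => // x y dxy g; rewrite ltNge; apply/negP => ed.
have /dP : K' (x, y).
  exists (iota g + x, iota g + y) => //=.
  by rewrite opprD addrACA subrr add0r.
by rewrite leNgt dxy.
Qed.

Lemma rotation_min_equicontinuous :
  min_equicontinuous_system (fun (g : G) (x : X) => iota g + x).
Proof.
split => //.
- split.
  + by move=> z; rewrite iota0 add0r.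
  + by move=> g h z; rewrite iotaD addrA.
  + move=> z; apply: (@continuous_comp _ _ _ (fun p : G * X => (iota p.1, p.2))
      (fun w : X * X => w.1 + w.2)); last exact: add_continuous.
    apply: cvg_pair; last exact: cvg_snd.
    by apply: (@continuous_comp _ _ _ fst iota); [exact: cvg_fst|exact: iota_cont].
- exact: group_metrizable.
- move=> z; apply/seteqP; split=> // x _ B xB.
  have : closure (range iota) (x - z) by rewrite iota_dense.
  have : nbhs (x - z) [set y | B (y + z)].
    by apply: (@addr_continuous X z (x - z)); rewrite subrK.
  move=> /[swap] /[apply] -[_ [[g _ <-] /= Bg]].
  by exists (iota g + z); split => //; exists g.
- exact: rotation_equicontinuous.
Qed.

End rotation.

(** * Lifting the support of the Mirsky measure to the torus *)

Section torus_parametrisation.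
Variables (G X : topologicalZmodType) (M : topologicalType).
Variables (iota : G -> X) (m : set X -> \bar R) (nu : X -> M) (act : G -> M -> M).
Hypotheses (hX : hausdorff_space X) (cX : compact [set: X]) (scX : @second_countable X).
Hypotheses (hm : haar_probability m).
Hypotheses (iotaD : forall g h, iota (g + h) = iota g + iota h)
  (iota_cont : continuous iota) (iota_dense : closure (range iota) = setT).
Hypotheses (actD : forall g h y, act (g + h) y = act g (act h y))
  (act_cont : forall g, continuous (act g))
  (nu_equiv : forall g x, nu (iota g + x) = act g (nu x)).
(* The sets [A n] form a countable Borel network for the topology that [nu]
   pulls back from [M]; [M] itself need not be second countable. *)
Variable A : nat -> set X.
Hypotheses (bA : forall n, Borel (A n))
  (netA : forall U x, open U -> U (nu x) ->
    exists2 n, A n x & A n `<=` nu @^-1` U).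

Let bm : borel_measure m. Proof. by case: hm => -[[]]. Qed.
Let mT : m setT = 1%E. Proof. by case: hm. Qed.
Let hh : haar_measure m. Proof. by case: hm. Qed.

Local Notation Y := (top_support (push_meas m nu)).
Local Notation graph := (range (fun x => (nu x, x))).
Local Notation Yt := (transitive_points act Y).

Lemma preimage_networkE U : open U ->
  nu @^-1` U = \bigcup_n (if `[< A n `<=` nu @^-1` U >] then A n else set0).
Proof.
move=> oU; apply/seteqP; split=> [x Ux|x [n _]].
  by have [n Ax AU] := netA oU Ux; exists n => //; rewrite asboolT.
by case: asboolP => // AU /AU.
Qed.

Lemma preimage_Borel U : open U -> Borel (nu @^-1` U).
Proof.
move=> oU; rewrite preimage_networkE//; apply: Borel_bigcup => n.
by case: asboolP => _; [exact: bA|exact: Borel0].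
Qed.

Lemma gt0_or_null B : Borel B -> (0 < m B)%E \/ m B = 0%E.
Proof.
move=> bB; have := borel_measure_ge0 bm bB; rewrite le_eqVlt => /orP[/eqP->|]; by [right|left].
Qed.

Lemma preimage_pos U : open U -> (0 < m (nu @^-1` U))%E ->
  exists n, A n `<=` nu @^-1` U /\ (0 < m (A n))%E.
Proof.
move=> oU; apply: contraPP => nex; rewrite preimage_networkE//.
rewrite (borel_measure_bigcup0 bm) ?ltxx// => n.
  by case: asboolP => _; [exact: bA|exact: Borel0].
case: asboolP => [AU|_]; last by case: bm.
by case: (gt0_or_null (bA n)) => // A0; exfalso; apply: nex; exists n.
Qed.

(** The exceptional set: off the null members of the network [nu x] lies in the support. This gives
    the support full measure without a countable base of [M]. *)
Let N := \bigcup_n (if `[< m (A n) = 0%E >] then A n else set0).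

Let bN : Borel N.
Proof. by apply: Borel_bigcup => n; case: asboolP => _; [exact: bA|exact: Borel0]. Qed.

Let N0 : m N = 0%E.
Proof.
apply: (borel_measure_bigcup0 bm) => n; first by case: asboolP => _; [exact: bA|exact: Borel0].
by case: asboolP => // _; case: bm.
Qed.

Let nN_supp x : ~ N x -> Y (nu x).
Proof.
move=> nNx U oU Ux; have [n Ax AU] := netA oU Ux.
have An : (0 < m (A n))%E.
  case: (gt0_or_null (bA n)) => // A0; exfalso; apply: nNx.
  by exists n => //; rewrite asboolT.
by apply: lt_le_trans An _; apply: le_borel_measure => //; exact: preimage_Borel.
Qed.

Lemma pos_meets_support B : Borel B -> (0 < m B)%E -> exists2 x, B x & Y (nu x).
Proof.
move=> bB; apply: contraPP => nex; rewrite lt_neqAle => /andP[+ _]; apply/negP; rewrite negbK.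
rewrite eq_le borel_measure_ge0//= -N0; apply: le_borel_measure => // x Bx.
by apply: contrapT => /nN_supp Yx; apply: nex; exists x.
Qed.

Lemma closed_support : closed Y.
Proof.
move=> y cy U oU Uy; have [z [Yz Uz]] := cy U (open_nbhs_nbhs (conj oU Uy)).
exact: Yz.
Qed.

Lemma support_invariant g y : Y y -> Y (act g y).
Proof.
move=> Yy U oU Uy; rewrite /push_meas -(haar_preimage (iota g) hh (preimage_Borel oU)).
have oV : open (act g @^-1` U) by apply: open_comp => // z _; exact: act_cont.
have := Yy _ oV Uy; rewrite /push_meas; congr (0 < m _)%E.
by apply/seteqP; split=> x /=; rewrite nu_equiv.
Qed.

(** By ergodicity almost every [x] has a translate in each [A n] of positive measure, and every open
    set meeting the support contains the image of such an [A n]. *)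
Lemma exists_transitive : exists x, Yt (nu x).
Proof.
have [B [oB bB]] := countable_base_seq scX.
(* One group element for each base member that meets the range of [iota]: countably many translates
   that are already dense, which keeps the sets [E n] Borel. *)
have /choice [D DP] : forall k, exists g, (exists g', B k (iota g')) -> B k (iota g).
  by move=> k; have [[g Bg]|nB] := pselect (exists g', B k (iota g')); [exists g|exists 0].
have dD : closure (range (fun k => iota (D k))) = setT.
  apply/seteqP; split=> // x _ V; rewrite nbhsE => -[Q [oQ Qx] QV].
  have [k Bx BQ] := bB _ _ (open_nbhs_nbhs (conj oQ Qx)).
  have : closure (range iota) x by rewrite iota_dense.
  move=> /(_ _ (open_nbhs_nbhs (conj (oB k) Bx))) [_ [[g _ <-] Bg]].
  exists (iota (D k)); split; first by exists k.
  by apply: QV; apply: BQ; apply: DP; exists g.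
pose E n := \bigcup_k [set x | A n (iota (D k) + x)].
have bE n : Borel (E n) by apply: Borel_bigcup => k; exact: Borel_shift.
have E0 n : (0 < m (A n))%E -> m (~` E n) = 0%E.
  move=> An; case: (gt0_or_null (BorelC (bE n))) => // En.
  have [_ [k _ <-] pos] := haar_ergodic hX cX scX hm (BorelC (bE n)) (bA n) En An dD.
  rewrite (_ : _ `&` _ = set0) in pos; first by case: bm pos => -> _ _; rewrite ltxx.
  by apply/seteqP; split=> // x [nE Ax]; apply: nE; exists k.
pose C := \bigcup_n (if `[< (0 < m (A n))%E >] then ~` E n else set0).
have bC n : Borel (if `[< (0 < m (A n))%E >] then ~` E n else set0).
  by case: asboolP => _; [exact: BorelC|exact: Borel0].
have C0 : m C = 0%E.
  apply: (borel_measure_bigcup0 bm) => // n.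
  by case: asboolP => [/E0//|_]; case: bm.
have : (0 < m (~` C))%E.
  case: (gt0_or_null (BorelC (Borel_bigcup bC))) => // nC.
  have := borel_measureU bm (Borel_bigcup bC) (BorelC (Borel_bigcup bC)) (setICr _).
  by rewrite setUv mT -/C C0 nC adde0 => /eqP; rewrite onee_eq0.
move=> /(pos_meets_support (BorelC (Borel_bigcup bC))) [x nCx Yx].
exists x; split => //; apply/seteqP; split.
  apply: closure_sub_closed; first exact: closed_support.
  by move=> _ [g _ <-]; exact: support_invariant.
move=> y Yy V; rewrite nbhsE => -[U [oU Uy] UV].
have [n [AU An]] := preimage_pos oU (Yy U oU Uy).
have [k _ Ak] : E n x by apply: contrapT => nE; apply: nCx; exists n => //; rewrite asboolT.
exists (act (D k) (nu x)); split; first by exists (D k).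
by apply: UV; rewrite -nu_equiv; exact: AU.
Qed.

Lemma transitive_invariant g y : Yt y -> Yt (act g y).
Proof.
move=> [Yy cy]; split; first exact: support_invariant.
rewrite -[RHS]cy; congr closure; apply/seteqP; split=> _ [h _ <-].
  by exists (h + g) => //; rewrite actD.
by exists (h - g) => //; rewrite -actD subrK.
Qed.

Lemma graph_invariant g y a : closure graph (y, a) ->
  closure graph (act g y, iota g + a).
Proof.
move=> cg V nV.
have : nbhs (y, a) [set z : M * X | V (act g z.1, iota g + z.2)].
  have cf : {for (y, a), continuous (fun z : M * X => (act g z.1, iota g + z.2))}.
    apply: cvg_pair.
      by apply: (@continuous_comp _ _ _ fst (act g)); [exact: cvg_fst|exact: act_cont].
    apply: (@continuous_comp _ _ _ snd (fun x => iota g + x)); first exact: cvg_snd.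
    exact: addl_continuous.
  exact: (cf V nV).
move=> /cg [_ [[x _ <-] /= Vx]]; exists (nu (iota g + x), iota g + x).
by split; [exists (iota g + x)|rewrite nu_equiv].
Qed.

Lemma graph_lift y : Y y -> exists a, closure graph (y, a).
Proof.
move=> Yy; apply: closure_proj_lift => // V; rewrite nbhsE => -[U [oU Uy] UV].
have [n [AU An]] := preimage_pos oU (Yy U oU Uy).
have [x Ax _] := pos_meets_support (bA n) An.
exists (nu x); split; last by apply: UV; exact: AU.
by exists (nu x, x) => //; exists x.
Qed.

Variable P : set X.
Hypotheses (bP : Borel P) (P0 : (0 < m P)%E)
  (P_unique : forall x a, P x -> closure graph (nu x, a) -> a = x).

Lemma graph_unique y a a' : Yt y -> closure graph (y, a) -> closure graph (y, a') -> a = a'.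
Proof.
move=> [Yy cy] ya ya'; have [x0 Px0 Yx0] := pos_meets_support bP P0.
pose S b := range (fun g => (act g y, iota g + b)).
have SE b : closure graph (y, b) -> closure (S b) `<=` closure graph.
  move=> yb; apply: closure_sub_closed; first exact: closed_closure.
  by move=> _ [g _ <-]; exact: graph_invariant.
have [b Sb] : exists b, closure (S a) (nu x0, b).
  apply: closure_proj_lift => //.
  rewrite (_ : [set p.1 | p in S a] = G_orbit act y) ?cy//.
  apply/seteqP; split=> [_ [_ [g _ <-] <-]|_ [g _ <-]]; first by exists g.
  by exists (act g y, iota g + a) => //; exists g.
(* Translation by [a' - a] in the torus coordinate maps [S a] onto [S a']. *)
have Sb' : closure (S a') (nu x0, b + (a' - a)).
  move=> V nV; have : nbhs (nu x0, b) [set z : M * X | V (z.1, z.2 + (a' - a))].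
    have cf : {for (nu x0, b), continuous (fun z : M * X => (z.1, z.2 + (a' - a)))}.
      apply: cvg_pair; first exact: cvg_fst.
      apply: (@continuous_comp _ _ _ snd (fun x => x + (a' - a))); first exact: cvg_snd.
      exact: addr_continuous.
    exact: (cf V nV).
  move=> /Sb [_ [[g _ <-] /= Vx]]; exists (act g y, iota g + a').
  split; first by exists g.
  by move: Vx; rewrite -addrA [a + _]addrC subrK.
have b0 := P_unique Px0 (SE _ ya _ Sb).
have := P_unique Px0 (SE _ ya' _ Sb'); rewrite b0 => /(canRL (addKr _)).
by rewrite addNr => /eqP; rewrite subr_eq0 => /eqP.
Qed.

(** Some lift of [y], which [graph_unique] makes the only one at a transitive point; the default [0]
    is for points without a lift. *)
Definition torus_map (y : M) : X := xget 0 [set a | closure graph (y, a)].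

Lemma torus_mapP y : Y y -> closure graph (y, torus_map y).
Proof.
move=> /graph_lift [a ya].
exact: (@xgetPex _ 0 [set a | closure graph (y, a)] (ex_intro _ a ya)).
Qed.

Lemma torus_map_factor : generic_factor_map act Y (fun g x => iota g + x) torus_map.
Proof.
split.
  apply: (@closed_graph_continuous _ _ (closure graph)) => //; first exact: closed_closure.
    by move=> y [Yy _]; exact: torus_mapP.
  by move=> y a ty ya; exact: graph_unique ty ya (torus_mapP ty.1).
move=> g y ty; apply: (@graph_unique (act g y)); first exact: transitive_invariant.
  exact: torus_mapP (transitive_invariant g ty).1.
exact: graph_invariant (torus_mapP ty.1).
Qed.

(** * Maximality of the torus *)

Section universal.
Variables (Z : topologicalType) (actZ : G -> Z -> Z) (psi : M -> Z).
Hypotheses (mesZ : min_equicontinuous_system actZ)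
  (psi_factor : generic_factor_map act Y actZ psi).

(* Steinhaus: if [iota g] is small then [g] moves some transitive point within
   a given open set, hence displaces every point of [Z] only a little. *)
Lemma small_displacement (d : Z -> Z -> R) y e : compatible_metric d -> Yt y -> 0 < e ->
  \forall t \near (0 : X), forall g, iota g = t -> d (actZ g (psi y)) (psi y) < e.
Proof.
move=> cd ty e0; have [_ _ _ _ ec] := mesZ.
have e2 : 0 < e / 2 by rewrite divr_gt0.
have [del d0 delP] := ec d cd (e / 2) e2.
(* The bound [del] feeds equicontinuity, which returns [e / 2] after acting by [g]; the bound
   [e / 2] is the other half of the final triangle inequality. *)
pose r := Num.min del (e / 2).
have r0 : 0 < r by rewrite lt_min d0 e2.
have [/subspace_continuousP cpsi psiE] := psi_factor.
have : nbhs y [set z | Yt z -> d (psi y) (psi z) < r].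
  exact: (cpsi y ty _ (cmetric_nbhs cd (psi y) r0)).
rewrite nbhsE => -[U [oU Uy] UP].
have Upos : (0 < m (nu @^-1` U))%E by case: ty => Yy _; exact: Yy.
have := haar_steinhaus hX cX hm (preimage_Borel oU) Upos.
apply: filterS => t tpos g gt.
have oV : open (U `&` act g @^-1` U).
  by apply: openI => //; apply: open_comp => // z _; exact: act_cont.
have [x [Ux Utx] Yx] : exists2 x, (nu @^-1` U `&` [set x | (nu @^-1` U) (t + x)]) x & Y (nu x).
  by apply: pos_meets_support tpos; apply: BorelI; [|apply: Borel_shift]; exact: preimage_Borel.
have [_ cy] := ty.
(* The dense orbit of [y] enters the open set of points that lie in [U] and are sent into [U] by
   [g]. *)
have : closure (G_orbit act y) (nu x) by rewrite cy.
have Vx : (U `&` act g @^-1` U) (nu x).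
  by split => //=; rewrite -nu_equiv gt.
move=> /(_ _ (open_nbhs_nbhs (conj oV Vx))) [_ [[h _ <-] [Uh Ugh]]].
have th := transitive_invariant h ty.
have := UP _ Uh th; have := UP _ Ugh (transitive_invariant g th).
rewrite psiE// => d1 d2.
have dd : d (psi y) (psi (act h y)) < del by apply: lt_le_trans d2 _; rewrite ge_min lexx.
have d3 := delP _ _ dd g.
have d1' : d (psi y) (actZ g (psi (act h y))) < e / 2.
  by apply: lt_le_trans d1 _; rewrite ge_min lexx orbT.
apply: le_lt_trans (cmetric_tri cd _ (actZ g (psi (act h y))) _) _.
by rewrite [X in _ < X]splitr ltrD// (cmetric_sym cd).
Qed.

(** The graph of [pi] is the closure of the orbit of [(x0, z0)] in the product of the torus with
    [Z]. Points over every [x] exist as [Z] is compact, and are unique by [small_displacement]. *)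
Lemma universal_factor : exists pi : X -> Z,
  factor_map (fun g x => iota g + x) actZ pi /\
  forall y, Yt y -> psi y = pi (torus_map y).
Proof.
have [[act0 aD acont] [cZ hZ] [d cd] minZ ec] := mesZ.
have [x1 tx1] := exists_transitive.
pose y0 := nu x1; have ty0 : Yt y0 by [].
pose x0 := torus_map y0; pose z0 := psi y0.
pose S := range (fun g => (iota g + x0, actZ g z0)).
have iotaB g h : iota (g - h) = iota g - iota h.
  by apply: (addIr (iota h)); rewrite -iotaD !subrK.
have cz g : continuous (actZ g).
  move=> z; apply: (@continuous_comp _ _ _ (fun z => (g, z)) (fun p : G * Z => actZ p.1 p.2)).
    by apply: cvg_pair; [exact: cvg_cst|exact: cvg_id].
  exact: acont.
have Suniq x z z' : closure S (x, z) -> closure S (x, z') -> z = z'.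
  move=> xz xz'; have [dE _ _ _] := cd; apply/dE.
  apply/eqP; rewrite eq_le cmetric_ge0// andbT; apply/ler_addgt0Pr => e e0; rewrite add0r.
  have e3 : 0 < e / 3 by rewrite divr_gt0.
  have [del d0 delP] := ec d cd _ e3.
  have [V [V0 VP]] := nbhs0_split (small_displacement cd ty0 d0).
  have nb w : nbhs (x, w) [set p : X * Z | V (p.1 - x) /\ d w p.2 < e / 3].
    exists ([set x' | V (x' - x)], [set w' | d w w' < e / 3]) => //=.
    by split; [exact: nbhs_sub|exact: cmetric_nbhs].
  (* Two orbit points over nearby torus points come from [g] and [h] with [iota (g - h)] small. So
     [g - h] moves [z0] by less than [del], and acting by [h] leaves the two values within
     [e / 3]. *)
  have [_ [[g _ <-] /= [Vg dg]]] := xz _ (nb z).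
  have [_ [[h _ <-] /= [Vh dh]]] := xz' _ (nb z').
  have gh : iota (g - h) = iota g + x0 - x - (iota h + x0 - x).
    by rewrite iotaB [in RHS]opprB [in RHS]addrA subrK opprD addrACA subrr addr0.
  have dgh := VP _ _ Vg Vh _ gh.
  have := delP _ _ dgh h; rewrite -aD addrC subrK => dh'.
  have := cmetric_tri cd z (actZ g z0) z'; have := cmetric_tri cd (actZ g z0) (actZ h z0) z'.
  rewrite (cmetric_sym cd (actZ h z0) z'); lra.
have Sex x : exists z, closure S (x, z).
  apply: closure_proj_lift => // V xV.
  have : closure (range iota) (x - x0) by rewrite iota_dense.
  have : nbhs (x - x0) [set y | V (y + x0)].
    by apply: (@addr_continuous X x0 (x - x0)); rewrite subrK.
  move=> /[swap] /[apply] -[_ [[g _ <-] /= Vg]]; exists (iota g + x0); split => //.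
  by exists (iota g + x0, actZ g z0) => //; exists g.
have /choice [pi piP] := Sex.
have pi_cont : continuous pi.
  have : {within setT, continuous pi}.
    apply: (@closed_graph_continuous _ _ (closure S)) => //; first exact: closed_closure.
    by move=> x z _ xz; exact: Suniq xz (piP x).
  move=> /subspace_continuousP h x; have := h x Logic.I.
  by rewrite withinET.
have pi_equiv g x : pi (iota g + x) = actZ g (pi x).
  apply: (Suniq (iota g + x)) => // V nV.
  have : nbhs (x, pi x) [set p : X * Z | V (iota g + p.1, actZ g p.2)].
    have cf : {for (x, pi x), continuous (fun p : X * Z => (iota g + p.1, actZ g p.2))}.
      apply: cvg_pair.
        apply: (@continuous_comp _ _ _ fst (fun x => iota g + x)); first exact: cvg_fst.
        exact: addl_continuous.
      by apply: (@continuous_comp _ _ _ snd (actZ g)); [exact: cvg_snd|exact: cz].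
    exact: (cf V nV).
  move=> /(piP x) [_ [[h _ <-] /= Vh]].
  exists (iota (g + h) + x0, actZ (g + h) z0); split; first by exists (g + h).
  by rewrite iotaD aD -addrA.
have pix0 g : pi (iota g + x0) = actZ g z0.
  by apply: (Suniq (iota g + x0)) => //; apply: subset_closure; exists g.
exists pi; split.
  split => //; apply/seteqP; split=> // z _.
  have cR : closed (range pi) by apply: compact_closed => //; exact: continuous_compact_image.
  apply: (closure_sub_closed cR (_ : G_orbit actZ z0 `<=` range pi)).
    by move=> _ [g _ <-]; exists (iota g + x0).
  by rewrite minZ.
have [psi_cont psiE] := psi_factor; have [tm_cont tmE] := torus_map_factor.
move=> y ty.
(* Both maps are continuous on the transitive points and agree on the orbit of [y0], which is dense
   among them. *)
apply: (@eq_on_dense _ _ Yt (G_orbit act y0) psi (pi \o torus_map)) => //.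
- apply/subspace_continuousP => w tw; apply: cvg_comp; last exact: pi_cont.
  by move/subspace_continuousP : tm_cont; exact.
- by move=> _ [g _ <-]; exact: transitive_invariant.
- by move=> w [Yw _]; case: ty0 => _ ->.
- move=> w; rewrite inE => -[g _ <-] /=.
  by rewrite psiE// tmE// pix0.
- by rewrite inE.
Qed.

End universal.

Theorem torus_max_equicontinuous_generic_factor :
  max_equicontinuous_generic_factor act Y (fun g x => iota g + x) torus_map.
Proof.
split.
- exact: rotation_min_equicontinuous.
- exact: torus_map_factor.
- by move=> Z actZ psi mesZ fZ; exact: universal_factor.
Qed.

End torus_parametrisation.

(** * The torus of a cut and project scheme *)

Section cut_project.
Variables (G H Xh : topologicalZmodType) (L : set (G * H)) (q : G * H -> Xh).
Hypothesis cap : cut_and_project L q.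

Let hG : hausdorff_space G. Proof. by case: cap => -[]. Qed.
Let hH : hausdorff_space H. Proof. by case: cap => _ -[]. Qed.
Let scG : @second_countable G. Proof. by case: cap => -[]. Qed.
Let scH : @second_countable H. Proof. by case: cap => _ -[]. Qed.
Let qD y z : q (y + z) = q y + q z. Proof. by case: cap => _ _ []. Qed.
Let qcont : continuous q. Proof. by case: cap => _ _ [_ []]. Qed.
Let qopen U : open U -> open (q @` U).
Proof. by case: cap => _ _ [_ [_ h] _ _ _] _ _; exact: h. Qed.
Let qL y : q y = 0 <-> L y.
Proof. by case: cap => _ _ [_ _ [h _] _ _] _ _; exact: h. Qed.

Let hGH : hausdorff_space (G * H)%type. Proof. exact: prod_hausdorff. Qed.
Let scGH : @second_countable (G * H)%type. Proof. exact: prod_second_countable. Qed.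

Lemma torus_compact : compact [set: Xh].
Proof. by case: cap => _ _ []. Qed.

Lemma torus_surj x : exists y, q y = x.
Proof.
have : [set: Xh] x by [].
by case: cap => _ _ [_ _ _ <- _] _ _ [y _ yx]; exists y.
Qed.

Lemma torus0 : q 0 = 0.
Proof. by apply: (addrI (q 0)); rewrite -qD !addr0. Qed.

Lemma torusB y z : q (y - z) = q y - q z.
Proof. by apply: (addIr (q z)); rewrite -qD !subrK. Qed.

(** Local injectivity of [q] in translation invariant form: the differences of points of [V] lie in
    a neighbourhood [U] that meets [L] only in [0]. *)
Lemma torus_discrete : exists V : set (G * H), nbhs (0 : G * H) V /\
  forall a b, V a -> V b -> q a = q b -> a = b.
Proof.
have [U [U0 UL]] : exists U, nbhs (0 : G * H) U /\ U `&` L = [set 0].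
  by case: cap => _ _ [_ _ [_ h] _ _] _ _.
have [V [V0 VU]] := @nbhs0_split (prod_group G H) U U0; exists V; split => // a b Va Vb ab.
have : (U `&` L) (a - b) by split; [exact: VU|apply/qL; rewrite torusB ab subrr].
by rewrite UL => /eqP; rewrite subr_eq0 => /eqP.
Qed.

(** A small neighbourhood of [z] holds at most one lattice point, which can be separated from [z];
    so [L] is closed. Then [x - y] has an open neighbourhood without [0], and continuity of
    subtraction separates [x] from [y]. *)
Lemma torus_hausdorff : hausdorff_space Xh.
Proof.
apply: hausdorff_of_sep => x y xy.
have [z qz] := torus_surj (x - y).
have nz : ~ L z by move=> /qL; rewrite qz => /eqP; rewrite subr_eq0 => /eqP.
have [V [V0 Vinj]] := torus_discrete.
have zV := @nbhs_sub (prod_group G H) z V V0.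
have [Q [zQ QL]] : exists Q, nbhs z Q /\ forall l, Q l -> ~ L l.
  have [[l [Vl Ll]]|nl] := pselect (exists l, V (l - z) /\ L l); last first.
    by exists [set l | V (l - z)]; split => // l Vl Ll; apply: nl; exists l.
  have zl : z <> l by move=> e; apply: nz; rewrite e.
  have [A [B [oA oB Az Bl AB]]] := hausdorff_sepP hGH zl.
  exists (A `&` [set l | V (l - z)]); split.
    by apply: filterI => //; apply: open_nbhs_nbhs.
  move=> l' [Al' Vl'] Ll'.
  have /(addIr (- z)) ll' : l' - z = l - z.
    by apply: Vinj => //; rewrite !torusB ((qL l').2 Ll') ((qL l).2 Ll).
  have : (A `&` B) l by split => //; rewrite -ll'.
  by rewrite AB.
move: zQ; rewrite nbhsE => -[U [oU Uz] UQ].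
have nU : nbhs (x, y) [set w : Xh * Xh | (q @` U) (w.1 - w.2)].
  apply: (@sub_continuous Xh (x, y)); apply: open_nbhs_nbhs; split; first exact: qopen.
  by exists z.
case: nU => -[A B] /= [xA yB] ABU.
exists A°, B°; split; [exact: open_interior|exact: open_interior|exact: xA|exact: yB|].
apply/seteqP; split=> // w [/interior_subset Aw /interior_subset Bw].
have [l Ul] := ABU (w, w) (conj Aw Bw); rewrite /= subrr => /qL Ll.
exact: QL (UQ _ Ul) Ll.
Qed.

Lemma torus_second_countable : @second_countable Xh.
Proof.
have [B [oB bB]] := countable_base_seq scGH.
apply: (@second_countable_of_seq _ (fun n => q @` B n)); first by move=> n; exact: qopen.
move=> x U xU; have [y qy] := torus_surj x.
have : nbhs y (q @^-1` U) by apply: qcont; rewrite qy.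
by move=> /bB [n By BU]; exists n; [exists y|move=> _ [z Bz <-]; exact: BU].
Qed.

Definition torus_flow (g : G) : Xh := q (g, 0).

Lemma torus_flowD g h : torus_flow (g + h) = torus_flow g + torus_flow h.
Proof. by rewrite /torus_flow -qD; congr q; congr pair; rewrite /= addr0. Qed.

Lemma torus_flow_continuous : continuous torus_flow.
Proof.
move=> g; apply: (@continuous_comp _ _ _ (fun g => (g, 0)) q); last exact: qcont.
by apply: cvg_pair; [exact: cvg_id|exact: cvg_cst].
Qed.

(** Given [q (g, h)], choose [l] in [L] with [l.2] close to [h]; subtracting [l] shows that
    [q (g, l.2)] is the flow at [g - l.1]. *)
Lemma torus_flow_dense : closure (range torus_flow) = setT.
Proof.
apply/seteqP; split=> // x _ V xV; have [[g h] qy] := torus_surj x.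
have : nbhs (g, h) (q @^-1` V) by apply: qcont; rewrite qy.
case=> -[A B] /= [gA hB] AB.
have : closure [set y.2 | y in L] h by case: cap => _ _ _ _ ->.
move=> /(_ _ hB) [_ [[l Ll <-] Bl]].
exists (torus_flow (g - l.1)); split; first by exists (g - l.1).
suff -> : torus_flow (g - l.1) = q (g, l.2) by apply: AB; split => //=; exact: nbhs_singleton.
rewrite /torus_flow; have := qD (g - l.1, 0) l; rewrite ((qL l).2 Ll) addr0 => <-.
by congr q; case: (l) => a b; congr pair; rewrite /= ?subrK ?add0r.
Qed.

(* The points of a coset are uniformly separated, so a compact set meets it in
   finitely many of them. *)
Lemma coset_finite (K : set (G * H)) x : compact K -> finite_set ([set y | q y = x] `&` K).
Proof.
move=> cK; have [V [V0 Vinj]] := torus_discrete.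
have [s sP] : exists s : seq (G * H), forall y, K y ->
    exists2 a, a \in s & [set y : G * H | V (y - a)]° y.
  apply: compact_finite_subcover => //; first by move=> a; exact: open_interior.
  by move=> y Ky; exists y => //; exact: (@nbhs_sub (prod_group G H) y V V0).
(* At most one point of the coset lies in the translate of [V] by [a]; it is [c a], with [0] as a
   dummy witness when there is none. *)
have /choice [c cP] : forall a, exists y, forall y', q y' = x -> V (y' - a) -> y' = y.
  move=> a; have [[y [qy Vy]]|ny] := pselect (exists y, q y = x /\ V (y - a)).
    exists y => y' qy' Vy'; apply: (addIr (- a)); apply: Vinj => //.
    by rewrite !torusB qy qy'.
  by exists 0 => y' qy' Vy'; exfalso; apply: ny; exists y'.
apply: (@sub_finite_set _ _ [set` map c s]); last exact: finite_seq.
move=> y [qy /sP [a sa /interior_subset Va]] /=.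
by apply/mapP; exists a => //; exact: cP.
Qed.

Variable W : set H.
Hypothesis cW : compact W.

Definition coset_sum (F : G * H -> R) (x : Xh) : R :=
  \sum_(y \in [set y : G * H | q y = x /\ W y.2]) F y.

(** Replaces a sum over a possibly infinite coset by one over a finite list that carries all nonzero
    terms. *)
Lemma coset_sum_seq F x (p : seq (G * H)) : uniq p ->
  (forall y, y \in p -> q y = x /\ W y.2) ->
  (forall y, q y = x -> W y.2 -> y \notin p -> F y = 0) ->
  coset_sum F x = \sum_(y <- p) F y.
Proof.
move=> up pP p0; rewrite /coset_sum (fsbigE p)//; last first.
  by move=> y [qy Wy]; exact: p0.
rewrite big_seq_cond [RHS]big_seq_cond; apply: eq_bigl => y; rewrite andbT.
by case: (boolP (y \in p)) => //= /pP h; exact: mem_set.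
Qed.

Lemma coset_seq (C : set (G * H)) x : compact C ->
  exists2 p : seq (G * H), uniq p & forall y, y \in p <-> [/\ q y = x, W y.2 & C y].
Proof.
move=> cC; have : finite_set ([set y : G * H | q y = x /\ W y.2] `&` C).
  apply: sub_finite_set (coset_finite x cC).
  by move=> y [[qy _] Cy].
move=> /finite_seqP [s sE]; exists (undup s); first exact: undup_uniq.
move=> y; rewrite mem_undup; split=> [ys|[qy Wy Cy]].
  have : [set` s] y by [].
  by rewrite -sE => -[[]].
by have : [set` s] y by rewrite -sE.
Qed.

Lemma coset_sum_gt0 F (K : set (G * H)) x y : compact K ->
  (forall z, W z.2 -> F z != 0 -> K z) -> (forall z, 0 <= F z) ->
  q y = x -> W y.2 -> 0 < F y -> 0 < coset_sum F x.
Proof.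
move=> cK FK F0 qy Wy Fy; have [p up pP] := coset_seq x cK.
rewrite (@coset_sum_seq F x p)//.
- have yp : y \in p by apply/pP; split => //; apply: FK => //; rewrite gt_eqF.
  by rewrite (big_rem y)//= ltr_pwDl// sumr_ge0.
- by move=> z /pP [].
- move=> z qz Wz; apply: contraNeq => Fz; apply/pP; split => //; exact: FK.
Qed.

Lemma coset_sum_translate F g x :
  coset_sum F (torus_flow g + x) = coset_sum (fun y => F (y + (g, 0))) x.
Proof.
rewrite /coset_sum; apply: (reindex_fsbig (fun y : G * H => y + (g, 0))); split.
- by move=> y [qy Wy] /=; rewrite qD qy addrC addr0.
- by move=> y z _ _; exact: addIr.
- move=> y [qy Wy] /=; exists (y - (g, 0)); last by rewrite subrK.
  by rewrite /= torusB qy addrC addKr subr0.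
Qed.

End cut_project.

(** * A countable Borel network for the coset measures *)

Section network.
Variables (G H Xh : topologicalZmodType) (L : set (G * H)) (q : G * H -> Xh).
Hypothesis cap : cut_and_project L q.
Variable W : set H.
Hypothesis cW : compact W.

Let hH : hausdorff_space H. Proof. by case: cap => _ -[]. Qed.
Let qcont : continuous q. Proof. by case: cap => _ _ [_ []]. Qed.

Let GW := [set y : G * H | W y.2].

Let closed_GW : closed GW.
Proof.
apply: (@closed_comp _ _ snd W); first by move=> z _; exact: cvg_snd.
exact: compact_closed.
Qed.

Variable O : nat -> set (G * H).
Hypotheses (oO : forall n, open (O n)) (cO : forall n, compact (closure (O n)))
  (bO : forall y U, nbhs y U -> exists2 n, O n y & closure (O n) `<=` U).

(* [inl n]: the coset has a point in [closure (O n)] over the window;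
   [inr (s, t)]: all its points in the union of [closure (O i)], [i \in s], over
   the window lie in the union of the [O j], [j \in t]. *)
Definition network_atom (i : nat + seq nat * seq nat) : set Xh :=
  match i with
  | inl n => q @` (closure (O n) `&` GW)
  | inr (s, t) => ~` (q @` ((\big[setU/set0]_(i <- s) closure (O i) `\`
      \big[setU/set0]_(j <- t) O j) `&` GW))
  end.

Definition network_set (s : seq (nat + seq nat * seq nat)) : set Xh :=
  [set x | forall i, i \in s -> network_atom i x].

(** Each atom is the image under [q] of a compact set, or the complement of such an image. *)
Lemma Borel_network_set s : Borel (network_set s).
Proof.
have hX := torus_hausdorff cap.
elim: s => [|i s IH].
  by rewrite (_ : network_set [::] = setT); [exact: BorelT|apply/seteqP; split].
rewrite (_ : network_set (i :: s) = network_atom i `&` network_set s); last first.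
  apply/seteqP; split=> [x h|x [ix sx] j].
    by split; [apply: h; rewrite mem_head|move=> j js; apply: h; rewrite in_cons js orbT].
  by rewrite in_cons => /predU1P[->//|/sx].
apply: BorelI => //; case: i => [n|[I J]] /=.
  apply: Borel_compact => //; apply: continuous_compact_image => //.
  exact: compact_closedI.
apply: BorelC; apply: Borel_compact => //; apply: continuous_compact_image => //.
rewrite setDE; apply: compact_closedI => //; apply: compact_closedI.
  by apply: bigsetU_compact => i _; exact: cO.
by apply: open_closedC; elim/big_ind: _ => [|A B|i _]; [exact: open0|exact: openU|exact: oO].
Qed.

Definition network (n : nat) : set Xh :=
  if unpickle n is Some s then network_set s else set0.

Lemma Borel_network n : Borel (network n).
Proof. by rewrite /network; case: unpickle => [s|]; [exact: Borel_network_set|exact: Borel0]. Qed.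

Lemma network_set_cat s t : network_set (s ++ t) = network_set s `&` network_set t.
Proof.
apply/seteqP; split=> [x h|x [sx tx] i].
  by split=> i ii; apply: h; rewrite mem_cat ii ?orbT.
by rewrite mem_cat => /orP[/sx|/tx].
Qed.

(* Cosets close to [x] in the network have their points over the window near
   those of [x], in a one-to-one way on the compact set carrying [F]. *)
Lemma network_coset_sum (F : G * H -> R) (K : set (G * H)) x e :
  continuous F -> compact K -> (forall y, W y.2 -> F y != 0 -> K y) -> 0 < e ->
  exists2 s, network_set s x &
    forall x', network_set s x' -> `|coset_sum q W F x - coset_sum q W F x'| < e.
Proof.
move=> cF cK FK e0.
have [I IP] : exists I : seq nat, forall y, K y -> exists2 i, i \in I & O i y.
  apply: compact_finite_subcover => // y _.
  by have [n Oy _] := bO (@filterT _ (nbhs y) _); exists n.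
pose C := \big[setU/set0]_(i <- I) closure (O i).
have cC : compact C by apply: bigsetU_compact => i _; exact: cO.
have KC y : K y -> C y.
  move=> /IP [i iI Oy]; rewrite /C -bigcup_seq; exists i => //; exact: subset_closure.
have [p up pP] := coset_seq cap W x cC.
have [V [V0 Vinj]] := torus_discrete cap.
(* There are [size p] error terms; the successor keeps the total strictly below [e] and covers an
   empty [p]. *)
pose e' := e / (size p).+1%:R.
have e'0 : 0 < e' by rewrite divr_gt0.
have /choice [n nP] : forall y, exists n, O n y /\
    closure (O n) `<=` [set z | V (z - y) /\ `|F y - F z| < e'].
  move=> y; have nb : nbhs y [set z : G * H | V (z - y) /\ `|F y - F z| < e'].
    apply: filterI; first exact: (@nbhs_sub (prod_group G H) y V V0).
    by have /continuousR_distP := cF y; exact.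
  by have [k Oy kP] := bO nb; exists k.
pose J := map n p.
(* The [inl] atoms provide a point of the new coset near each point of [p]; the [inr] atom rules out
   points over the window in [C] that are near none of them. *)
exists (inr (I, J) :: map (fun y => inl (n y)) p).
  move=> i; rewrite in_cons => /predU1P[->|/mapP [y yp ->]] /=.
    move=> [y [[Cy nJ] Wy] qy]; apply: nJ; rewrite -bigcup_seq.
    exists (n y) => /=; last by case: (nP y).
    by apply/map_f/pP.
  have [qy Wy Cy] := (pP y).1 yp.
  by exists y => //; split => //; apply: subset_closure; case: (nP y).
move=> x' x'P.
have x'IJ := x'P _ (mem_head _ _); rewrite /= -/C in x'IJ.
have /choice [c cP] : forall y, exists y', y \in p ->
    [/\ q y' = x', W y'.2 & closure (O (n y)) y'].
  move=> y; have [yp|_] := boolP (y \in p); last by exists y.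
  have : network_atom (inl (n y)) x'.
    by apply: x'P; rewrite in_cons map_f ?orbT.
  by move=> [y' [Oy' Wy'] qy']; exists y'.
have qB := torusB cap.
(* The offsets [c y - y] and [c z - z] lie in [V] and both map to [x' - x], hence they coincide. *)
have cinj : {in p &, injective c}.
  move=> y z yp zp cyz; have [qy _ Oy] := cP y yp; have [qz _ Oz] := cP z zp.
  have [Vy _] := (nP y).2 _ Oy; have [Vz _] := (nP z).2 _ Oz.
  have h : c y - y = c z - z.
    apply: Vinj => //; rewrite !qB qy qz.
    by have [-> _ _] := (pP y).1 yp; have [-> _ _] := (pP z).1 zp.
  by move: h; rewrite cyz => /addrI /oppr_inj.
have -> : coset_sum q W F x = \sum_(y <- p) F y.
  apply: coset_sum_seq => //; first by move=> y /pP [].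
  move=> y qy Wy; apply: contraNeq => Fy; apply/pP; split => //.
  by apply: KC; exact: FK.
have -> : coset_sum q W F x' = \sum_(y <- map c p) F y.
  apply: coset_sum_seq.
  - by rewrite map_inj_in_uniq.
  - by move=> _ /mapP [y yp ->]; have [] := cP y yp.
  move=> y' qy' Wy'; apply: contraNeq => Fy'.
  have Cy' : C y' by apply: KC; exact: FK.
  have : (\big[setU/set0]_(j <- J) O j) y'.
    by apply: contrapT => nJ; apply: x'IJ; exists y'.
  rewrite -bigcup_seq => -[_ /= /mapP [y yp ->] Oy'].
  apply/mapP; exists y => //; have [qc _ Oc] := cP y yp.
  have [Vc _] := (nP y).2 _ Oc; have [Vy' _] := (nP y).2 _ (subset_closure Oy').
  apply: (addIr (- y)); apply: Vinj => //.
  by rewrite !qB qy' qc.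
rewrite big_map -sumrB.
apply: le_lt_trans (ler_norm_sum _ _ _) _.
apply: (@le_lt_trans _ _ (\sum_(y <- p) e')).
  rewrite big_seq [X in _ <= X]big_seq; apply: ler_sum => y yp.
  have [_ _ Oc] := cP y yp.
  by apply: ltW; have [] := (nP y).2 _ Oc.
rewrite big_const_seq count_predT iter_addr_0 -[_ *+ size p]mulr_natr /e' mulrAC.
by rewrite ltr_pdivrMr// ltr_pM2l// ltr_nat.
Qed.

End network.

(** * Coset measures in the vague topology *)

Lemma ptws_eval_continuous (I : Type) (i : I) :
  continuous (fun mu : {ptws I -> R} => mu i).
Proof.
move=> mu A nA; have h : nbhs mu --> (mu : {ptws I -> R}) by exact: cvg_id.
have /cvg_sup/(_ i) := h; apply.
by have := @initial_continuous _ _ (fun f : (I -> R) => f i) mu A nA.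
Qed.

Lemma ptws_cvg (I S : Type) (F : set_system S) (FF : Filter F) (h : S -> {ptws I -> R})
    (l : {ptws I -> R}) :
  (forall i e, 0 < e -> F [set s | `|l i - h s i| < e]) -> h @ F --> l.
Proof.
move=> hl; apply/cvg_sup => i U [V [[Q oQ <-] Ql] QU].
have /(@nbhs_ballP R R) [e e0 eQ] : nbhs (l i) Q by apply: open_nbhs_nbhs.
have hF : F [set s | Q (h s i)].
  by apply: filterS (hl i e e0) => s /= hs; apply: (eQ (h s i)); exact: hs.
by apply: (@filterS S F FF _ _ _ hF) => s Qs; exact: (QU (h s)).
Qed.

(* [nu_W] and [nuG_W] are the cases [p = id] and [p = fst]. *)
Section mirsky.
Variables (G H Xh : topologicalZmodType) (L : set (G * H)) (q : G * H -> Xh).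
Hypothesis cap : cut_and_project L q.
Variable W : set H.
Hypothesis cW : compact W.
Variables (T : topologicalType) (p : G * H -> T).
Hypotheses (pcont : continuous p)
  (p_proper : forall K, compact K ->
    exists2 K' : set (G * H), compact K' & forall y, W y.2 -> K (p y) -> K' y).

Definition coset_measure (x : Xh) : Mspace T :=
  fun f => coset_sum q W (sval f \o p) x.

Lemma Cc_coset_support (f : Cc T) : exists2 K : set (G * H), compact K &
  forall y, W y.2 -> (sval f \o p) y != 0 -> K y.
Proof.
have [K cK KP] := p_proper (proj2_sig f).2.
by exists K => // y Wy fy; apply: KP => //; exact: subset_closure.
Qed.

Lemma Cc_coset_continuous (f : Cc T) : continuous (sval f \o p).
Proof. by move=> y; apply: continuous_comp; [exact: pcont|exact: (proj2_sig f).1]. Qed.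

Lemma coset_measure_network : exists A : nat -> set Xh, (forall n, Borel (A n)) /\
  forall U x, open U -> U (coset_measure x) ->
    exists2 n, A n x & A n `<=` coset_measure @^-1` U.
Proof.
have [[hG lG scG] [hH lH scH] _ _ _] := cap.
have [D [oD cD bD]] := locally_compact_base (prod_hausdorff hG hH)
  (prod_locally_compact hG hH lG lH) (prod_second_countable scG scH).
exists (network q W D); split; first by move=> n; apply: (Borel_network cap cW).
move=> U x oU Ux.
(* The filter generated by the network sets containing [x]: convergence of [coset_measure] along it
   places one of them inside the preimage of [U]. *)
pose F : set_system Xh := [set A | exists2 s, network_set q W D s x & network_set q W D s `<=` A].
have FF : Filter F.
  split.
  - by exists [::].
  - move=> A B [s sx sA] [t tx tB]; exists (s ++ t); rewrite network_set_cat; first by split.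
    by move=> z [/sA Az /tB Bz].
  - by move=> A B AB [s sx sA]; exists s => // z /sA /AB.
have : coset_measure @ F --> coset_measure x.
  apply: ptws_cvg => f e e0; have [K cK KP] := Cc_coset_support f.
  have [s sx sP] := network_coset_sum cap oD cD bD x (@Cc_coset_continuous f) cK KP e0.
  by exists s.
move=> /(_ U (open_nbhs_nbhs (conj oU Ux))) [s sx sU].
by exists (pickle s); rewrite /network pickleK.
Qed.

(** A bump function at [p y] has positive integral at [x]. The graph closure gives a torus point in
    [B] whose integral is still nonzero, so that its measure has an atom in [N]. *)
Lemma graph_atom x y a (N : set T) (B : set Xh) :
  hausdorff_space T -> locally_compact [set: T] ->
  closure (range (fun x => (coset_measure x, x))) (coset_measure x, a) ->
  q y = x -> W y.2 -> nbhs (p y) N -> nbhs a B ->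
  exists y', [/\ B (q y'), W y'.2 & N (p y')].
Proof.
move=> hT lT cl qy Wy yN aB; apply: contrapT => nex.
have [f [f0 fy fN]] := Cc_bump hT lT yN.
have [K cK KP] := Cc_coset_support f.
have fx : 0 < coset_measure x f.
  by apply: (coset_sum_gt0 cap cK KP _ qy Wy) => // z; exact: f0.
have /continuousR_distP /(_ _ fx) nv := @ptws_eval_continuous (Cc T) f (coset_measure x).
have : nbhs (coset_measure x, a) [set z : Mspace T * Xh |
    `|coset_measure x f - z.1 f| < coset_measure x f /\ B z.2].
  by exists ([set w : Mspace T | `|coset_measure x f - w f| < coset_measure x f], B).
move=> /cl [_ [[x' _ <-] /= [h Bx']]]; move: h.
have -> : coset_measure x' f = 0.
  apply: fsbig1 => y' [qy' Wy']; apply: fN => Ny'; apply: nex.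
  by exists y'; split => //; rewrite qy'.
by rewrite subr0 gtr0_norm// ltxx.
Qed.

End mirsky.

(** * Translations of measures *)

Lemma Cc_eq (T : topologicalType) (f g : Cc T) : sval f = sval g -> f = g.
Proof.
by case: f g => [f hf] [g hg] /= e; rewrite e in hf *; congr exist; exact: Prop_irrelevance.
Qed.

Section translation_action.
Variable T : topologicalZmodType.
Implicit Types (a b : T) (f : Cc T) (mu : Mspace T).

Lemma Cc_translate a f : is_Cc (sval f \o (fun y => y + a)).
Proof.
have [cf kf] := proj2_sig f; split.
  by move=> y; apply: continuous_comp; [exact: addr_continuous|exact: cf].
have cK : compact [set y + - a | y in closure [set x | sval f x != 0]].
  by apply: continuous_compact_image => //; exact: addr_continuous.
apply: (subclosed_compact _ cK); first exact: closed_closure.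
apply: (@subset_trans _ ((fun y => y + a) @^-1` closure [set x | sval f x != 0])).
  apply: closure_sub_closed; last by move=> y fy; exact: subset_closure.
  by apply: closed_comp => [y _|]; [exact: addr_continuous|exact: closed_closure].
by move=> y fy; exists (y + a) => //; rewrite addrK.
Qed.

Definition translate_measure a mu : Mspace T :=
  fun f => mu (Cc_comp (fun y => y + a) f).

Lemma sval_Cc_comp a f : sval (Cc_comp (fun y => y + a) f) = sval f \o (fun y => y + a).
Proof. by rewrite /Cc_comp; case: pselect => // n; exfalso; apply: n; exact: Cc_translate. Qed.

Lemma translate_measureD a b mu :
  translate_measure (a + b) mu = translate_measure a (translate_measure b mu).
Proof.
apply/funext => f; congr (mu _); apply: Cc_eq; rewrite !sval_Cc_comp.
by apply/funext => y /=; rewrite addrAC addrA.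
Qed.

Lemma translate_measure_continuous a : continuous (translate_measure a).
Proof.
move=> mu; apply: ptws_cvg => f e e0.
have /continuousR_distP := @ptws_eval_continuous (Cc T) (Cc_comp (fun y => y + a) f) mu.
by apply.
Qed.

End translation_action.

(** Restricted to a compact set, the Haar measure of [H] becomes finite and so fits
    [fubini_null]. *)
Lemma borel_measure_restr (T : topologicalZmodType) (mu : set T -> \bar R) (V : set T) :
  borel_measure mu -> Borel V -> borel_measure (fun A => mu (A `&` V)).
Proof.
move=> [m0 mge madd] bV; split.
- by rewrite set0I.
- by move=> A bA; apply: mge; exact: BorelI.
- move=> F bF tF; rewrite setI_bigcupl; apply: madd; first by move=> i; exact: BorelI.
  by apply: trivIset_setIr.
Qed.

(** * The cosets that meet a window *)

Section window.
Variables (G H Xh : topologicalZmodType) (L : set (G * H)) (q : G * H -> Xh).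
Variables (mH : set H -> \bar R) (mXh : set Xh -> \bar R).
Hypotheses (cap : cut_and_project L q) (hmH : haar_measure mH)
  (hmX : haar_probability mXh).

Let hG : hausdorff_space G. Proof. by case: cap => -[]. Qed.
Let hH : hausdorff_space H. Proof. by case: cap => _ -[]. Qed.
Let lG : locally_compact [set: G]. Proof. by case: cap => -[]. Qed.
Let lH : locally_compact [set: H]. Proof. by case: cap => _ -[]. Qed.
Let scG : @second_countable G. Proof. by case: cap => -[]. Qed.
Let scH : @second_countable H. Proof. by case: cap => _ -[]. Qed.
Let qD y z : q (y + z) = q y + q z. Proof. by case: cap => _ _ []. Qed.
Let qcont : continuous q. Proof. by case: cap => _ _ [_ []]. Qed.
Let qopen U : open U -> open (q @` U).
Proof. by case: cap => _ _ [_ [_ h] _ _ _] _ _; exact: h. Qed.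
Let hX := torus_hausdorff cap.
Let cX := torus_compact cap.
Let scX := torus_second_countable cap.
Let bmH : borel_measure mH. Proof. by case: hmH => -[]. Qed.
Let bmX : borel_measure mXh. Proof. by case: hmX => -[[]]. Qed.
Let hhX : haar_measure mXh. Proof. by case: hmX. Qed.

Definition window_cosets (W : set H) : set Xh := q @` [set y | W y.2].

(** The strip over [W] is a countable union of compact sets because [G] is, and their images under
    [q] are compact. *)
Lemma Borel_window_cosets W : compact W -> Borel (window_cosets W).
Proof.
move=> cW; have [B [oB cB bB]] := locally_compact_base hG lG scG.
rewrite (_ : window_cosets W = \bigcup_n (q @` (closure (B n) `*` W))).
  apply: Borel_bigcup => n; apply: Borel_compact => //.
  by apply: continuous_compact_image => //; exact: compact_setX.
apply/seteqP; split=> [_ [y Wy <-]|_ [n _ [y [_ Wy] <-]]]; last by exists y.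
have [n Bn _] := bB _ _ (@filterT _ (nbhs y.1) _).
by exists n => //; exists y => //; split => //; exact: subset_closure.
Qed.

Lemma window_cosets_flow W g x : window_cosets W (torus_flow q g + x) -> window_cosets W x.
Proof.
move=> [y Wy yx]; exists (y - (g, 0)); first by rewrite /= subr0.
by rewrite (torusB cap) yx addrC addKr.
Qed.

(* Fubini on [Xh * H]: translating along [H] sees the [mH]-measure of the window. *)
Lemma window_cosets_pos W : compact W -> (0 < mH W)%E -> (0 < mXh (window_cosets W))%E.
Proof.
move=> cW W0; have bN := Borel_window_cosets cW.
rewrite lt0e (borel_measure_ge0 bmX bN) andbT; apply/negP => /eqP N0.
(* For [h0] in [C] the compact set [V], the difference of [W] and [C], contains the whole translate
   of [W] by [- h0]. *)
have [C [C0 cC _]] := locally_compact_nbhs (0 : H) lH.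
pose V := (fun z : H * H => z.1 - z.2) @` (W `*` C).
have cV : compact V.
  by apply: continuous_compact_image; [exact: sub_continuous|exact: compact_setX].
have bV : Borel V by exact: Borel_compact.
pose E := [set z : Xh * H | window_cosets W (q (0, z.2) + z.1)].
have bE : Borel E.
  apply: (@Borel_preimage _ _ (fun z : Xh * H => q (0, z.2) + z.1)) => // z.
  apply: (@continuous_comp _ _ _ (fun z : Xh * H => (q (0, z.2), z.1))
    (fun w : Xh * Xh => w.1 + w.2)).
    apply: cvg_pair; last exact: cvg_fst.
    apply: (@continuous_comp _ _ _ (fun z : Xh * H => (0, z.2)) q); last exact: qcont.
    by apply: cvg_pair; [exact: cvg_cst|exact: cvg_snd].
  exact: add_continuous.
have E0 h : mXh [set x | E (x, h)] = 0%E by rewrite (haar_preimage (q (0, h)) hhX bN).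
pose B := q @` (setT `*` C°).
have oB : open B by apply: qopen; apply: open_rect; [exact: openT|exact: open_interior].
have B0 : (0 < mXh B)%E.
  by apply: (haar_open_pos cX hmX oB (x := q 0)); exists 0.
have fX : (mXh setT < +oo)%E by case: hmX => _ ->; rewrite ltry.
have fV : (mH (setT `&` V) < +oo)%E.
  by rewrite setTI; case: hmH => -[_ + _ _] _ _; exact.
have [x [[g0 h0] /= [_ /interior_subset Ch0] qx] xV] := fubini_null bmX
  (borel_measure_restr bmH bV) fX fV scX scH bE E0 (Borel_open oB) B0.
have bW : Borel W by exact: Borel_compact.
(* For [x = q (g0, h0)] the null section contains every [h] with [h0 + h] in [W], a set with the
   measure of [W]. *)
have : (mH [set h | W (h0 + h)%R] <= 0)%E.
  rewrite -xV; apply: le_borel_measure => //; first exact: Borel_shift.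
    apply: BorelI => //; apply: (@Borel_preimage _ _ (fun h => (x, h))) bE => h.
    by apply: cvg_pair; [exact: cvg_cst|exact: cvg_id].
  move=> h Wh; split.
    exists (g0, h0 + h) => //; rewrite /= -qx -qD; congr q.
    by congr pair; rewrite /= ?add0r// addrC.
  by exists (h0 + h, h0) => //=; rewrite addrC addKr.
by rewrite (haar_preimage h0 hmH bW) leNgt W0.
Qed.

(** A zero-one law: these cosets form a set of positive measure invariant under the flow, and the
    flow is ergodic. *)
Lemma window_cosets_full W : compact W -> (0 < mH W)%E ->
  mXh (~` window_cosets W) = 0%E.
Proof.
move=> cW W0; have bN := Borel_window_cosets cW; have bC := BorelC bN.
have [C0|//] := gt0_or_null hmX bC.
have [_ [g _ <-] pos] := haar_ergodic hX cX scX hmX bC bN C0 (window_cosets_pos cW W0)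
  (torus_flow_dense cap).
rewrite (_ : _ `&` _ = set0) in pos; first by case: bmX pos => -> _ _; rewrite ltxx.
by apply/seteqP; split=> // x [nN /window_cosets_flow].
Qed.

End window.

(** * The two cases of the theorem *)

Section weak_model_sets.
Variables (G H Xh : topologicalZmodType) (L : set (G * H)) (q : G * H -> Xh).
Variables (mH : set H -> \bar R) (mXh : set Xh -> \bar R) (W : set H).
Hypotheses (cap : cut_and_project L q) (hmH : haar_measure mH)
  (hmX : haar_probability mXh) (cW : compact W) (W0 : (0 < mH W)%E).

Let hG : hausdorff_space G. Proof. by case: cap => -[]. Qed.
Let hH : hausdorff_space H. Proof. by case: cap => _ -[]. Qed.
Let lG : locally_compact [set: G]. Proof. by case: cap => -[]. Qed.
Let lH : locally_compact [set: H]. Proof. by case: cap => _ -[]. Qed.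
Let scH : @second_countable H. Proof. by case: cap => _ -[]. Qed.
Let qcont : continuous q. Proof. by case: cap => _ _ [_ []]. Qed.
Let hX := torus_hausdorff cap.
Let cX := torus_compact cap.
Let scX := torus_second_countable cap.
Let bmH : borel_measure mH. Proof. by case: hmH => -[]. Qed.
Let bmX : borel_measure mXh. Proof. by case: hmX => -[[]]. Qed.
Let bW : Borel W. Proof. exact: Borel_compact. Qed.

(** The common form of both cases: [p] and [j] are the identity and the inclusion of [G] in the
    product, or [fst] and the identity of [G]. What remains for each case is a set [P] of uniquely
    lifted points. *)
Lemma coset_measure_max_factor (T : topologicalZmodType) (p : G * H -> T)
    (j : G -> T) (P : set Xh) :
  continuous p ->
  (forall K, compact K ->
    exists2 K' : set (G * H), compact K' & forall y, W y.2 -> K (p y) -> K' y) ->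
  (forall g h, j (g + h) = j g + j h) ->
  (forall y g, p (y + (g, 0)) = p y + j g) ->
  Borel P -> (0 < mXh P)%E ->
  (forall x a, P x ->
    closure (range (fun x => (coset_measure q W p x, x))) (coset_measure q W p x, a) ->
    a = x) ->
  exists phi : Mspace T -> Xh,
    max_equicontinuous_generic_factor (fun g => translate_measure (j g))
      (top_support (push_meas mXh (coset_measure q W p))) (torus_action q) phi.
Proof.
move=> pcont pprop jD pj bP P0 PU.
have [A [bA netA]] := coset_measure_network cap cW pcont pprop.
eexists; apply: (@torus_max_equicontinuous_generic_factor G Xh (Mspace T) (torus_flow q) mXh
  (coset_measure q W p) (fun g => translate_measure (j g)) hX cX scX hmX
  (torus_flowD cap) (torus_flow_continuous cap) (torus_flow_dense cap) _ _ _ A bA netA P bP P0 PU).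
- by move=> g h mu; rewrite jD translate_measureD.
- by move=> g; exact: translate_measure_continuous.
- move=> g x; apply/funext => f; rewrite /coset_measure (coset_sum_translate cap).
  rewrite /translate_measure sval_Cc_comp; congr (coset_sum q W _ x).
  by apply/funext => y /=; rewrite pj.
Qed.

(** An atom [y] lies in the product itself, so [q] recovers the torus point from it: an atom near
    [y] forces every lift to be near [q y]. *)
Lemma nu_W_max_factor : exists phi : Mspace (G * H)%type -> Xh,
  max_equicontinuous_generic_factor (@M_action G H)
    (top_support (push_meas mXh (nu_W q W))) (torus_action q) phi.
Proof.
have := @coset_measure_max_factor (prod_group G H) id (fun g => (g, 0)) (window_cosets q W).
apply.
- by move=> y; exact: cvg_id.
- by move=> K cK; exists K.
- by move=> g h; congr pair; rewrite /= addr0.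
- by [].
- exact: (Borel_window_cosets cap).
- exact: (window_cosets_pos cap hmH hmX).
move=> x a [y Wy qy] cl; apply: contrapT => /(hausdorff_sepP hX) [A [B [oA oB Aa Bx AB]]].
have yB : nbhs y (q @^-1` B) by apply: qcont; rewrite qy; apply: open_nbhs_nbhs.
have pp (K : set (G * H)) : compact K ->
  exists2 K' : set (G * H), compact K' & forall y, W y.2 -> K (id y) -> K' y by exists K.
have [y' [Ay' _ By']] := graph_atom cap (T := prod_group G H) pp (prod_hausdorff hG hH)
  (prod_locally_compact hG hH lG lH) cl qy Wy yB (open_nbhs_nbhs (conj oA Aa)).
by have : (A `&` B) (q y') by []; rewrite AB.
Qed.

Section projection.
Hypothesis aper : haar_aperiodic mH W.

Let fst_proper (K : set G) : compact K ->
  exists2 K' : set (G * H), compact K' & forall y, W y.2 -> K y.1 -> K' y.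
Proof. by move=> cK; exists (K `*` W); [exact: compact_setX|move=> y Wy Ky]. Qed.

Local Notation graph := (range (fun x => (coset_measure q W fst x, x))).

(** The projected measure controls only the first coordinate of an atom. Compactness of [W] supplies
    the second: if no [h'] worked for [(g, a)], none would for nearby pairs. *)
Lemma projected_graph_atom x a g h : closure graph (coset_measure q W fst x, a) ->
  q (g, h) = x -> W h -> exists2 h', W h' & q (g, h') = a.
Proof.
move=> cl qx Wh; apply: contrapT => nex.
pose C := [set z : (G * Xh) * H | q (z.1.1, z.2) - z.1.2 = 0].
have cC : closed C.
  apply: (@closed_comp _ _ (fun z : (G * Xh) * H => q (z.1.1, z.2) - z.1.2) [set 0]); last first.
    by apply: compact_closed => //; exact: compact_set1.
  move=> z _; apply: (@continuous_comp _ _ _ (fun z : (G * Xh) * H => (q (z.1.1, z.2), z.1.2))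
    (fun w : Xh * Xh => w.1 - w.2)); last exact: sub_continuous.
  apply: cvg_pair.
    apply: (@continuous_comp _ _ _ (fun z : (G * Xh) * H => (z.1.1, z.2)) q); last exact: qcont.
    apply: cvg_pair; last exact: cvg_snd.
    by apply: (@continuous_comp _ _ _ fst fst z); exact: cvg_fst.
  by apply: (@continuous_comp _ _ _ fst snd z); [exact: cvg_fst|exact: cvg_snd].
have [] := @compact_avoid _ _ C W (g, a) cC cW.
  by move=> h' Wh' /eqP; rewrite subr_eq0 => /eqP qa; apply: nex; exists h'.
move=> [N B] /= [gN aB] NB.
have [y' [By' Wy' Ny']] := graph_atom cap fst_proper hG lG cl qx Wh gN aB.
apply: (NB (y'.1, q y') (conj Ny' By') y'.2 Wy').
by rewrite /C /= -surjective_pairing subrr.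
Qed.

Lemma nuG_W_max_factor : exists phi : Mspace G -> Xh,
  max_equicontinuous_generic_factor (@MG_action G)
    (top_support (push_meas mXh (nuG_W q W))) (torus_action q) phi.
Proof.
have [D [oD cD bD]] := locally_compact_base hH lH scH.
pose Wn n := W `&` closure (D n).
have cWn n : compact (Wn n) by apply: compact_closedI => //; exact: closed_closure.
(* Only pieces [Wn n] of positive measure impose a condition, and each such condition holds almost
   everywhere; hence [P] has full measure. *)
pose A n := if `[< (0 < mH (Wn n))%E >] then window_cosets q (Wn n) else setT.
pose P := \bigcap_n A n.
have bA n : Borel (A n).
  by rewrite /A; case: asboolP => _; [exact: (Borel_window_cosets cap)|exact: BorelT].
have bP : Borel P by exact: Borel_bigcap.
have A0 n : mXh (~` A n) = 0%E.
  rewrite /A; case: asboolP => [h|_]; first exact: (window_cosets_full cap hmH hmX).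
  by rewrite setCT; case: bmX.
have P0 : (0 < mXh P)%E.
  have [//|P0] := gt0_or_null hmX bP.
  have := borel_measureU bmX bP (BorelC bP) (setICr _).
  rewrite setUv P0 /P setC_bigcap (borel_measure_bigcup0 bmX) => [|n|//]; last exact: BorelC.
  by case: hmX => _ -> /eqP; rewrite adde0 onee_eq0.
have PO x U : P x -> open U -> (0 < mH (W `&` U))%E ->
    exists g h, [/\ q (g, h) = x, W h & U h].
  move=> Px oU WU.
  (* The part of [W] inside [U] is a countable union of pieces [Wn n], which cannot all be null. *)
  have [n nU n0] : exists2 n, closure (D n) `<=` U & (0 < mH (Wn n))%E.
    apply: contrapT => nex; pose F n := if `[< closure (D n) `<=` U >] then Wn n else set0.
    have bF n : Borel (F n).
      by rewrite /F; case: asboolP => _; [exact: Borel_compact|exact: Borel0].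
    have : mH (\bigcup_n F n) = 0%E.
      apply: (borel_measure_bigcup0 bmH) => // n; rewrite /F.
      case: asboolP => [nU|_]; last by case: bmH.
      apply/eqP; rewrite eq_le (borel_measure_ge0 bmH) ?andbT; last exact: Borel_compact.
      by rewrite leNgt; apply/negP => n0; apply: nex; exists n.
    rewrite (_ : \bigcup_n F n = W `&` U); first by move=> e; rewrite e ltxx in WU.
    apply/seteqP; split=> [h [n _]|h [Wh Uh]].
      by rewrite /F; case: asboolP => // nU [Wh /nU].
    have [n nh nU] := bD _ _ (open_nbhs_nbhs (conj oU Uh)).
    by exists n => //; rewrite /F asboolT//; split => //; exact: subset_closure.
  have := Px n Logic.I; rewrite /A asboolT// => -[[g h] [Wh nh] qx].
  by exists g, h; split => //; exact: nU.
apply: (@coset_measure_max_factor G fst id P) => //.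
  by move=> y; exact: cvg_fst.
move=> x a Px cl.
have [g0 [h0 [q0 Wh0 _]]] := PO x setT Px openT ltac:(by rewrite setIT).
have [h0' Wh0' q0'] := projected_graph_atom cl q0 Wh0.
have qB := torusB cap.
have [_ _ [_ _ [qL _] _ _] injL _] := cap.
(* The vertical displacement of one atom. The displacements of two atoms differ by an element of [L]
   with first coordinate [0], which vanishes as [fst] is injective on [L]; so every atom moves by
   the same [k]. *)
pose k := h0' - h0.
have shift g h : q (g, h) = x -> W h -> W (k + h).
  move=> qx Wh; have [h' Wh' qa] := projected_graph_atom cl qx Wh.
  suff -> : k + h = h' by [].
  have L0 : L 0 by apply/qL; exact: torus0 cap.
  have Ld : L ((g, h') - (g, h) - ((g0, h0') - (g0, h0))).
    by apply/qL; rewrite !qB qx qa q0 q0' subrr.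
  have := injL _ _ (mem_set Ld) (mem_set L0).
  rewrite /= !subrr => /(_ erefl) [_] /eqP; rewrite subr_eq0 => /eqP e.
  by rewrite /k -e subrK.
pose hW := [set - k + w | w in W].
have hWE : hW = [set h | W (k + h)] by rewrite /hW translate_image opprK.
have bhW : Borel hW by rewrite hWE; exact: Borel_shift.
(* Otherwise the open complement of [hW] would contain the height of an atom of [x], contradicting
   [shift]. *)
have WD : mH (W `\` hW) = 0%E.
  have [pos|//] : (0 < mH (W `\` hW))%E \/ mH (W `\` hW) = 0%E.
    have := borel_measure_ge0 bmH (BorelD bW bhW).
    by rewrite le_eqVlt => /orP[/eqP->|]; [right|left].
  have ohW : open (~` hW).
    apply: closed_openC; apply: compact_closed => //; exact: compact_translate.
  have [g [h [qx Wh nh]]] := PO x (~` hW) Px ohW pos.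
  by exfalso; apply: nh; rewrite hWE; exact: shift qx Wh.
(* [W] and its translate [hW] have the same finite measure, so the opposite difference is null
   too. *)
have DW : mH (hW `\` W) = 0%E.
  have e : mH hW = mH W by rewrite hWE (haar_preimage k hmH bW).
  have fI : mH (W `&` hW) \is a fin_num.
    rewrite ge0_fin_numE; last by apply: (borel_measure_ge0 bmH); exact: BorelI.
    apply: le_lt_trans (_ : mH W < +oo)%E; last by case: hmH => -[_ + _ _] _ _; exact.
    by apply: le_borel_measure => //; exact: BorelI.
  move: e; rewrite (borel_measureDI bmH bhW bW) (borel_measureDI bmH bW bhW) WD add0e setIC.
  by move=> /(congr1 (fun z => z - mH (W `&` hW))%E); rewrite addeK// subee.
have k0 : - k = 0.
  apply: aper; rewrite -/hW; apply/eqP; rewrite eq_le (borel_measure_ge0 bmH) ?andbT; last first.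
    by apply: BorelU; exact: BorelD.
  rewrite (borel_measureU bmH) ?DW ?WD ?adde0//; [exact: BorelD|exact: BorelD|].
  by apply/seteqP; split=> // h [[_ nW] [Wh _]].
have k00 : k = 0 by rewrite -[k]opprK k0 oppr0.
have e0 : h0' = h0 by apply/eqP; rewrite -subr_eq0; apply/eqP.
by rewrite -q0' e0.
Qed.

End projection.
End weak_model_sets.

Theorem mainTheorem14 (G H Xh : topologicalZmodType)
  (L : set (G * H)) (q : G * H -> Xh)
  (mH : set H -> \bar R) (mXh : set Xh -> \bar R) (W : set H) :
  cut_and_project L q ->
  haar_measure mH ->
  haar_probability mXh ->
  compact W -> (0 < mH W)%E ->
  (exists phi : Mspace (G * H)%type -> Xh,
     max_equicontinuous_generic_factor (@M_action G H)
       (top_support (push_meas mXh (nu_W q W))) (torus_action q) phi) /\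
  (haar_aperiodic mH W ->
   exists phi : Mspace G -> Xh,
     max_equicontinuous_generic_factor (@MG_action G)
       (top_support (push_meas mXh (nuG_W q W))) (torus_action q) phi).
Proof.
move=> cap hmH hmX cW W0; split.
  exact: nu_W_max_factor cap hmH hmX cW W0.
by move=> aper; exact: nuG_W_max_factor cap hmH hmX cW W0 aper.
Qed.
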